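(* There is a bijection between topological quasi-Lie bialgebras $(\mathfrak g[\![x]\!],\delta,\varphi)$ and skew-symmetric $(n,s)$-type series. Let $r$ be the $(n,s)$-type series corresponding to $(\mathfrak g[\![x]\!],\delta,\varphi)$; then, under the identification $\mathfrak g[\![x]\!]\cong\Delta$, we have the following identities: - $[a\otimes1+1\otimes a,r]=-\delta(a)$ for any $a\in\mathfrak g[\![x]\!]$, and - $\mathrm{CYB}(r)=-\varphi$. The same is true if $r$ is interpreted as an element in $(\mathfrak g\otimes\mathfrak g)(\!(x)\!)[\![y]\!]$.
   Context: $F$ is an algebraically closed field of characteristic $0$ (discrete topology), $\mathfrak g$ a finite-dimensional simple Lie algebra over $F$, $\{b_i\}_{i=1}^d$ a basis orthonormal for the Killing form $\kappa$, $\Omega=\sum_ib_i\otimes b_i$. $\mathfrak g[\![x]\!]=\mathfrak g\otimes F[\![x]\!]$ has bracket $[a\otimes f,b\otimes g]=[a,b]\otimes fg$ and the $(x)$-adic topology; $\mathfrak g[\![x]\!]'$ is its continuous dual. **Topological quasi-Lie bialgebra structure** on $\mathfrak g[\![x]\!]$: a skew-symmetric continuous linear map $\delta:\mathfrak g[\![x]\!]\to(\mathfrak g\otimes\mathfrak g)[\![x,y]\!]$ and a skew-symmetric element $\varphi\in(\mathfrak g\otimes\mathfrak g\otimes\mathfrak g)[\![x,y,z]\!]$ such that (1) $\delta([a,b])=[a\otimes1+1\otimes a,\delta(b)]-[b\otimes1+1\otimes b,\delta(a)]$; (2) $\frac12\mathrm{Alt}((\delta\otimes1)\delta(a))=[a\otimes1\otimes1+1\otimes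 a\otimes1+1\otimes1\otimes a,\varphi]$; (3) $\mathrm{Alt}((\delta\otimes1\otimes1)\varphi)=0$. Here $(\mathfrak g^{\otimes m})[\![x_1,\dots,x_m]\!]$ is regarded as the completed tensor power of $\mathfrak g[\![x]\!]$ (permutations of tensor factors also permute variables; $a\otimes1+1\otimes a$ means $a(x)\otimes1+1\otimes a(y)$, etc.) and $\mathrm{Alt}(x_1\otimes\dots\otimes x_m)=\sum_{\sigma\in S_m}\mathrm{sgn}(\sigma)x_{\sigma(1)}\otimes\dots\otimes x_{\sigma(m)}$. **Series of type $(n,s)$.** For an integer $n\ge0$ let $A=F(\!(x)\!)\times F[x]/(x^n)$, $L_n=\mathfrak g\otimes A=\mathfrak g(\!(x)\!)\times\mathfrak g[x]/x^n\mathfrak g[x]$, $\Delta=\{(f,[f])\mid f\in\mathfrak g[\![x]\!]\}\subset L_n$. Write $b(f,[p])$ for $b\otimes(f,[p])$. $F[\![x]\!]$ acts by $s\cdot(f,[p])=(sf,[sp])$. Elements of $(L_n\otimes\mathfrak g)[\![y]\!]$ are written $\sum_{k\ge0}\sum_if_{k,i}\otimes b_iy^k$ with $f_{k,i}\in L_n$, where $y^k$ stands for $(y^k,[y]^k)$. One interprets $\frac{y^n\Omega}{x-y}:=\sum_{k\ge0}\sum_iw_{k,i}\otimes b_iy^k$ with $w_{k,i}=b_i(0,-[x]^{n-1-k})$ for $0\le k\le n-1$ and $w_{k,i}=b_i(x^{n-1-k},0)$ for $k\ge n$. $(\mathfrak g\otimes\mathfrak g)[\![x,y]\!]$ is embedded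 via $\mathfrak g[\![x]\!]\cong\Delta$. For $s\in F[\![x]\!]^\times$, a series of type $(n,s)$ is $r=\frac{s(x)y^n\Omega}{x-y}+g(x,y)$ with $g\in(\mathfrak g\otimes\mathfrak g)[\![x,y]\!]$. Let $\tau$ be the $F[\![x,y]\!]$-linear extension of $a\otimes b\mapsto b\otimes a$ and $\overline r=\frac{s(y)x^n\Omega}{x-y}-\tau(g(y,x))$, meaning $\frac{s(x)y^n\Omega}{x-y}-\frac{s(x)y^n-s(y)x^n}{x-y}\Omega-\tau(g(y,x))$ with $\frac{s(x)y^n-s(y)x^n}{x-y}\in F[\![x,y]\!]$. The series $r$ is skew-symmetric if $r=\overline r$. Interpreting $r$ in $(\mathfrak g\otimes\mathfrak g)(\!(x)\!)[\![y]\!]$ means projecting $L_n$ to its first component, equivalently reading $\frac{y^n\Omega}{x-y}$ as $\Omega\sum_{k\ge0}x^{-k-1}y^{n+k}$. **CYB.** $\mathrm{CYB}(r)=[r^{12},r^{13}]+[r^{12},r^{23}]+[r^{13},r^{23}]$, where for $r=\sum f_{k,i}\otimes b_iy^k$: $r^{12}=\sum f_{k,i}(x_1)\otimes b_ix_2^k\otimes1$, $r^{13}=\sum f_{k,i}(x_1)\otimes1\otimes b_ix_3^k$, $r^{23}=\sum1\otimes f_{k,i}(x_2)\otimes b_ix_3^k$ in $U(\mathfrak g)^{\otimes3}\otimes A_3$, with $A_1=A$ in the variable $x_1$, $A_m=A_{m-1}(\!(x_m)\!)\oplus A_{m-1}[x_m]/x_m^nA_{m-1}$ and $x_j^k$ standing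 for $(x_j^k,[x_j]^k)$. For the interpretation in $(\mathfrak g\otimes\mathfrak g)(\!(x)\!)[\![y]\!]$ the same formula is computed over $F(\!(x_1)\!)(\!(x_2)\!)[\![x_3]\!]$. **The correspondence.** For a sequence $\alpha=(\alpha_i\in F\mid-\infty<i\le n-2)$ put $\alpha(x)=x^{-n}+\alpha_{n-2}x^{-n+1}+\dots+\alpha_0x^{-1}+\dots$ (for $n=0$: $1+\alpha_{-2}x+\dots$), and let $L(n,\alpha)$ be $L_n$ with the form $B(a\otimes(f,[p]),b\otimes(g,[q]))=\kappa(a,b)\,\mathrm{res}_0\{\alpha(x)(fg-pq)\}$. A skew-symmetric series $r=\sum f_{k,i}\otimes b_iy^k$ of type $(n,s)$ with $s=\frac1{x^n\alpha(x)}$ determines the subspace $W(r)=\mathrm{span}_F\{f_{k,i}\}\subset L(n,\alpha)$, which is Lagrangian (equal to its orthogonal complement) and complementary to $\Delta$. A Lagrangian subspace $W$ complementary to $\Delta\cong\mathfrak g[\![x]\!]$ is identified through the form with $\mathfrak g[\![x]\!]'$; writing $[f,g]=p_1(f\otimes g)+p_2(f\otimes g)$ for $f,g\in W$, with $p_1(f\otimes g)\in\Delta$, $p_2(f\otimes g)\in W$, the corresponding quasi-Lie bialgebra structure has $\delta$ the dual map of $p_2$ and $\varphi=-\psi$, where $\langle f\otimes g\otimes h,\psi\rangle=\langle h,p_1(f\otimes g)\rangle$ for all $f,g,h\in W$.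
   Formalization: The bijection is with those topological quasi-Lie bialgebras that are given by a Lagrangian subspace of some L(n,α) complementary to Δ; without this it fails, e.g. δ=0, φ=0 corresponds to no series of type (n,s). Here s may be any unit, so α has leading coefficient 1/s(0). *)

(* Defs.v *)
From HB Require Import structures.
From mathcomp Require Import all_boot all_order all_algebra all_fingroup.
From mathcomp Require Import finmap.
From mathcomp Require Import boolp classical_sets functions cardinality fsbigop.
From mathcomp Require Import zify.

Set Implicit Arguments.
Unset Strict Implicit.
Unset Printing Implicit Defensive.

Import Order.TTheory GRing.Theory Num.Theory.
Local Open Scope ring_scope.

(* R[[x]].  Iterated rings list the variables from the inside out:          *)
(* ps (ps R) is R[[x]][[y]] = R[[x,y]], and a l k is the coefficient        *)
(* of x^k y^l.                                                              *)

Record ps (R : Type) := Ps { psf :> nat -> R }.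

Lemma psP (R : Type) (a b : ps R) : (forall k, a k = b k) -> a = b.
Proof. by case: a b => a [b] /= ab; congr Ps; apply/funext. Qed.

HB.instance Definition _ (R : Type) := gen_eqMixin (ps R).
HB.instance Definition _ (R : Type) := gen_choiceMixin (ps R).

Section PsZmod.
Variable R : zmodType.
Definition ps_add (a b : ps R) := Ps (fun k => a k + b k).
Definition ps_opp (a : ps R) := Ps (fun k => - a k).
Definition ps_zero : ps R := Ps (fun=> 0).

Fact ps_addA : associative ps_add.
Proof. by move=> a b c; apply: psP => k /=; rewrite addrA. Qed.
Fact ps_addC : commutative ps_add.
Proof. by move=> a b; apply: psP => k /=; rewrite addrC. Qed.
Fact ps_add0 : left_id ps_zero ps_add.
Proof. by move=> a; apply: psP => k /=; rewrite add0r. Qed.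
Fact ps_addN : left_inverse ps_zero ps_opp ps_add.
Proof. by move=> a; apply: psP => k /=; rewrite addNr. Qed.
HB.instance Definition _ :=
  GRing.isZmodule.Build (ps R) ps_addA ps_addC ps_add0 ps_addN.
End PsZmod.

Section PsRing.
Variable R : comPzRingType.

Definition psC (c : R) : ps R := Ps (fun k => if k == 0%N then c else 0).
Definition psX : ps R := Ps (fun k => (k == 1%N)%:R).
Definition ps_mul (a b : ps R) : ps R :=
  Ps (fun k => \sum_(i < k.+1) a i * b (k - i)%N).

Lemma ps_mulE_rev (a b : ps R) k :
  ps_mul a b k = \sum_(i < k.+1) a (k - i)%N * b i.
Proof.
rewrite /= (reindex_inj rev_ord_inj) /=; apply: eq_bigr => i _.
by rewrite subSS subKn // -ltnS.
Qed.

Fact ps_mulC : commutative ps_mul.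
Proof.
move=> a b; apply: psP => k; rewrite ps_mulE_rev /=.
by apply: eq_bigr => i _; rewrite mulrC.
Qed.

Fact ps_mulA : associative ps_mul.
Proof.
move=> a b c; apply: psP => i; rewrite [in RHS]ps_mulE_rev /=.
pose coef3 j k := a j * (b (i - j - k)%N * c k).
transitivity (\sum_(j < i.+1) \sum_(k < i.+1 | (k <= i - j)%N) coef3 j k).
  apply: eq_bigr => /= j _.
  rewrite -[\sum_(k < (i - j).+1) _]/(ps_mul b c (i - j)%N) ps_mulE_rev.
  by rewrite big_distrr /= (big_ord_narrow_leq (leq_subr _ _)).
rewrite (exchange_big_dep predT) //=; apply: eq_bigr => k _.
transitivity (\sum_(j < i.+1 | (j <= i - k)%N) coef3 j k).
  apply: eq_bigl => j; rewrite -ltnS -(ltnS j) -!subSn ?leq_ord //.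
  by rewrite -subn_gt0 -(subn_gt0 j) -!subnDA addnC.
rewrite (big_ord_narrow_leq (leq_subr _ _)) mulr_suml; apply: eq_bigr => j _.
by rewrite /coef3 -!subnDA addnC mulrA.
Qed.

Fact ps_mul1 : left_id (psC 1) ps_mul.
Proof.
move=> a; apply: psP => k /=; rewrite big_ord_recl /= mul1r subn0 big1 ?addr0//.
by move=> i _; rewrite mul0r.
Qed.

Fact ps_mulD : left_distributive ps_mul +%R.
Proof.
move=> a b c; apply: psP => k /=; rewrite -big_split /=.
by apply: eq_bigr => i _; rewrite mulrDl.
Qed.

HB.instance Definition _ :=
  GRing.Zmodule_isComPzRing.Build (ps R) ps_mulA ps_mulC ps_mul1 ps_mulD.
End PsRing.

Definition ps_map (R S : Type) (f : R -> S) (a : ps R) : ps S :=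
  Ps (fun k => f (a k)).

(* f(x,y) |-> f(y,x) *)
Definition ps_swap (R : Type) (a : ps (ps R)) : ps (ps R) :=
  Ps (fun l => Ps (fun k => a k l)).

(* R((x)) *)
Definition ls_bounded (R : zmodType) (f : int -> R) :=
  exists N : nat, forall m : int, m < - N%:Z -> f m = 0.

Record ls (R : zmodType) := Ls { lsf :> int -> R; ls_bnd : ls_bounded lsf }.

Lemma lsP (R : zmodType) (a b : ls R) : (forall k, a k = b k) -> a = b.
Proof.
case: a b => a Ha [b Hb] /= /funext ab; case: b / ab Hb => Hb.
by congr Ls; apply: Prop_irrelevance.
Qed.

HB.instance Definition _ (R : zmodType) := gen_eqMixin (ls R).
HB.instance Definition _ (R : zmodType) := gen_choiceMixin (ls R).

Section LsZmod.
Variable R : zmodType.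
Implicit Types a b c : ls R.

Fact ls_add_bnd a b : ls_bounded (fun m => a m + b m).
Proof.
case: a b => a [N aN] [b [M bM]] /=; exists (N + M)%N => m mNM.
by rewrite aN ?bM ?addr0//; lia.
Qed.
Fact ls_opp_bnd a : ls_bounded (fun m => - a m).
Proof. by case: a => a [N aN]; exists N => m /aN /= ->; rewrite oppr0. Qed.
Fact ls_zero_bnd : ls_bounded (fun=> 0 : R). Proof. by exists 0%N. Qed.

Definition ls_add a b := Ls (ls_add_bnd a b).
Definition ls_opp a := Ls (ls_opp_bnd a).
Definition ls_zero := Ls ls_zero_bnd.

Fact ls_addA : associative ls_add.
Proof. by move=> a b c; apply: lsP => k /=; rewrite addrA. Qed.
Fact ls_addC : commutative ls_add.
Proof. by move=> a b; apply: lsP => k /=; rewrite addrC. Qed.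
Fact ls_add0 : left_id ls_zero ls_add.
Proof. by move=> a; apply: lsP => k /=; rewrite add0r. Qed.
Fact ls_addN : left_inverse ls_zero ls_opp ls_add.
Proof. by move=> a; apply: lsP => k /=; rewrite addNr. Qed.
HB.instance Definition _ :=
  GRing.isZmodule.Build (ls R) ls_addA ls_addC ls_add0 ls_addN.
End LsZmod.

Section LsRing.
Variable R : comPzRingType.
Implicit Types a b c : ls R.

(* the sum below has finite support, see ls_convE *)
Definition ls_conv (f g : int -> R) (m : int) : R :=
  \sum_(i \in [set: int]) f i * g (m - i).

Lemma ls_convE (f g : int -> R) (N M K : nat) (m : int) :
  (forall i : int, i < - N%:Z -> f i = 0) ->
  (forall i : int, i < - M%:Z -> g i = 0) ->
  m + N%:Z + M%:Z <= K%:Z ->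
  ls_conv f g m = \sum_(i < K.+1) f (i%:Z - N%:Z) * g (m - (i%:Z - N%:Z)).
Proof.
move=> fN gM mK; rewrite /ls_conv.
pose h (i : nat) : int := i%:Z - N%:Z.
have hinj : injective h by move=> i j; rewrite /h; lia.
rewrite (fsbigTE [fset x in [seq h i | i <- iota 0 K.+1]]%fset); last first.
  move=> i; rewrite in_fset => iK; have [iN|iN] := boolP (i < - N%:Z).
    by rewrite fN // mul0r.
  rewrite gM ?mulr0//; rewrite ltNge; apply: contra iK => iK.
  apply/mapP; exists (absz (i + N%:Z)%R); rewrite ?mem_iota /h; move: iN iK; rewrite -leNgt; lia.
rewrite (perm_big [seq h i | i <- iota 0 K.+1]); last first.
  apply: uniq_perm; rewrite ?fset_uniq ?map_inj_uniq ?iota_uniq// => x.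
  by rewrite in_fset.
by rewrite big_map -[iota 0 K.+1]/(index_iota 0 K.+1) big_mkord.
Qed.

Lemma ls_conv_small (f g : int -> R) (N M : nat) :
  (forall i : int, i < - N%:Z -> f i = 0) ->
  (forall i : int, i < - M%:Z -> g i = 0) ->
  forall m : int, m < - (N + M)%N%:Z -> ls_conv f g m = 0.
Proof.
move=> fN gM m mNM; rewrite (ls_convE (K := 0) fN gM); last by lia.
by rewrite big_ord1 gM ?mulr0//=; lia.
Qed.

Fact ls_mul_bnd a b : ls_bounded (ls_conv a b).
Proof.
case: a b => a [N aN] [b [M bM]] /=.
by exists (N + M)%N; apply: ls_conv_small.
Qed.

Definition ls_mul a b := Ls (ls_mul_bnd a b).

(* the power series x^N a, for a in x^-N R[[x]] *)
Definition ls_shift (N : nat) (f : int -> R) : ps R :=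
  Ps (fun k => f (k%:Z - N%:Z)).

Lemma ls_shift_conv (f g : int -> R) (N M : nat) :
  (forall i : int, i < - N%:Z -> f i = 0) ->
  (forall i : int, i < - M%:Z -> g i = 0) ->
  ls_shift (N + M) (ls_conv f g) = ls_shift N f * ls_shift M g.
Proof.
move=> fN gM; apply: psP => k /=; rewrite (ls_convE (K := k) fN gM); last by lia.
by apply: eq_bigr => i _; congr (_ * g _); have := ltn_ord i; lia.
Qed.

Lemma ls_shift_inj (f g : int -> R) (N : nat) :
  (forall i : int, i < - N%:Z -> f i = 0) ->
  (forall i : int, i < - N%:Z -> g i = 0) ->
  ls_shift N f = ls_shift N g -> forall m, f m = g m.
Proof.
move=> fN gN fg m; have [mN|mN] := boolP (m < - N%:Z); first by rewrite fN ?gN.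
have := congr1 (fun a : ps R => a (absz (m + N%:Z)%R)) fg => /=.
by have -> : (absz (m + N%:Z))%:Z - N%:Z = m by move: mN; rewrite -leNgt; lia.
Qed.

Definition ls_monom (x : R) (e : int) : int -> R :=
  fun m => if m == e then x else 0.
Fact ls_monom_bnd (x : R) e : ls_bounded (ls_monom x e).
Proof. by exists (absz e) => m mN; rewrite /ls_monom; case: eqP => //; lia. Qed.

(* the monomial x t^e, for x in R and t the variable *)
Definition lsM (x : R) (e : int) : ls R := Ls (ls_monom_bnd x e).
Definition lsC (x : R) : ls R := lsM x 0.
Definition lsX (e : int) : ls R := lsM 1 e.

Fact ls_mulC : commutative ls_mul.
Proof.
move=> a b; apply: lsP => /=; case: a b => a [N aN] [b [M bM]] /=.
apply: (ls_shift_inj (N := (N + M)%N)); try exact: ls_conv_small.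
  by rewrite addnC; apply: ls_conv_small.
by rewrite ls_shift_conv // addnC ls_shift_conv // mulrC.
Qed.

Fact ls_mulA : associative ls_mul.
Proof.
move=> a b c; apply: lsP => /=; case: a b c => a [N aN] [b [M bM]] [c [K cK]] /=.
have abB := ls_conv_small aN bM; have bcB := ls_conv_small bM cK.
apply: (ls_shift_inj (N := (N + M + K)%N)).
- by rewrite -addnA; apply: ls_conv_small.
- exact: ls_conv_small.
- rewrite [in RHS]ls_shift_conv // -addnA !ls_shift_conv //; exact: mulrA.
Qed.

Fact ls_mul1 : left_id (lsC 1) ls_mul.
Proof.
move=> a; apply: lsP => /=; case: a => a [N aN] /=.
have oneB (i : int) : i < - 0%:Z -> ls_monom 1 0 i = 0.
  by rewrite /ls_monom; case: eqP => // ->; lia.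
apply: (ls_shift_inj (N := (0 + N)%N)) => //; first exact: ls_conv_small.
rewrite ls_shift_conv // -[RHS]mul1r; congr (_ * _).
by apply: psP => k; rewrite /= /ls_monom; case: k.
Qed.

Fact ls_mulD : left_distributive ls_mul +%R.
Proof.
move=> a b c; apply: lsP => m /=; case: a b c => a [N aN] [b [M bM]] [c [K cK]].
rewrite /ls_conv /=; have aB (i : int) : i < - (N + M)%N%:Z -> a i = 0.
  by move=> ?; apply: aN; lia.
have bB (i : int) : i < - (N + M)%N%:Z -> b i = 0.
  by move=> ?; apply: bM; lia.
have abB (i : int) : i < - (N + M)%N%:Z -> a i + b i = 0.
  by move=> ?; rewrite aB ?bB ?addr0.
pose L := absz (m + (N + M)%N%:Z + K%:Z).
have LB : m + (N + M)%N%:Z + K%:Z <= L%:Z by rewrite /L; lia.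
have := ls_convE abB cK LB; have := ls_convE bB cK LB; have := ls_convE aB cK LB.
rewrite /ls_conv => -> -> ->; rewrite -big_split /=.
by apply: eq_bigr => i _; rewrite mulrDl.
Qed.

HB.instance Definition _ :=
  GRing.Zmodule_isComPzRing.Build (ls R) ls_mulA ls_mulC ls_mul1 ls_mulD.

Definition ps_ls_fun (a : ps R) (m : int) : R := if m is Posz k then a k else 0.
Fact ps_ls_bnd (a : ps R) : ls_bounded (ps_ls_fun a).
Proof. by exists 0%N => -[]. Qed.
(* R[[x]] in R((x)) *)
Definition ps_ls (a : ps R) : ls R := Ls (ps_ls_bnd a).

Definition ls_res (a : ls R) : R := a (-1).
End LsRing.

(* applies f to the coefficients; f is packaged as an additive map only to   *)
(* have f 0 = 0                                                              *)
Section LsMap.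
Variables (R S : zmodType) (f : {additive R -> S}).
Fact ls_map_bnd (a : ls R) : ls_bounded (fun m => f (a m)).
Proof. by case: a => a [N aN]; exists N => m /aN /= ->; rewrite raddf0. Qed.
Definition ls_map (a : ls R) : ls S := Ls (ls_map_bnd a).
End LsMap.

(* R[x]/(x^n), by representatives of degree < n; the zero ring for n = 0     *)
Record tp (n : nat) (R : zmodType) :=
  Tp { tpf :> nat -> R; tp_bnd : forall k, (n <= k)%N -> tpf k = 0 }.

Lemma tpP n (R : zmodType) (a b : tp n R) : (forall k, a k = b k) -> a = b.
Proof.
case: a b => a Ha [b Hb] /= /funext ab; case: b / ab Hb => Hb.
by congr Tp; apply: Prop_irrelevance.
Qed.

HB.instance Definition _ n (R : zmodType) := gen_eqMixin (tp n R).
HB.instance Definition _ n (R : zmodType) := gen_choiceMixin (tp n R).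

Section Tp.
Variables (n : nat) (R : zmodType).
Implicit Types a b c : tp n R.

Fact tp_trunc_bnd (f : nat -> R) k :
  (n <= k)%N -> (if (k < n)%N then f k else 0) = 0.
Proof. by rewrite leqNgt => /negbTE ->. Qed.
(* the class of a power series *)
Definition tp_trunc (f : ps R) : tp n R := Tp (tp_trunc_bnd f).
Definition tp_ps a : ps R := Ps a.

Lemma tp_ext a b : (forall k, (k < n)%N -> a k = b k) -> a = b.
Proof.
move=> ab; apply: tpP => k; have [/ab//|nk] := ltnP k n.
by rewrite !tp_bnd.
Qed.

Definition tp_add a b := tp_trunc (tp_ps a + tp_ps b).
Definition tp_opp a := tp_trunc (- tp_ps a).
Definition tp_zero := tp_trunc 0.

Fact tp_addA : associative tp_add.
Proof. by move=> a b c; apply: tp_ext => k /= kn; rewrite kn addrA. Qed.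
Fact tp_addC : commutative tp_add.
Proof. by move=> a b; apply: tp_ext => k /= kn; rewrite kn addrC. Qed.
Fact tp_add0 : left_id tp_zero tp_add.
Proof. by move=> a; apply: tp_ext => k /= kn; rewrite kn add0r. Qed.
Fact tp_addN : left_inverse tp_zero tp_opp tp_add.
Proof. by move=> a; apply: tp_ext => k /= kn; rewrite kn addNr. Qed.
HB.instance Definition _ :=
  GRing.isZmodule.Build (tp n R) tp_addA tp_addC tp_add0 tp_addN.
End Tp.
Arguments tp_trunc n {R}.

Section TpRing.
Variables (n : nat) (R : comPzRingType).
Implicit Types a b c : tp n R.

Definition tp_mul a b := tp_trunc n (tp_ps a * tp_ps b).

Lemma tp_mul_trunc (f g : ps R) :
  tp_mul (tp_trunc n f) (tp_trunc n g) = tp_trunc n (f * g).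
Proof.
apply: tp_ext => k kn /=; rewrite kn; apply: eq_bigr => i _.
by rewrite !(leq_ltn_trans _ kn) ?leq_subr// -ltnS.
Qed.

Lemma tp_psK a : tp_trunc n (tp_ps a) = a.
Proof. by apply: tp_ext => k /= ->. Qed.

Fact tp_mulA : associative tp_mul.
Proof.
move=> a b c; rewrite -[a]tp_psK -[b]tp_psK -[c]tp_psK.
by rewrite !tp_mul_trunc mulrA.
Qed.
Fact tp_mulC : commutative tp_mul.
Proof. by move=> a b; rewrite /tp_mul mulrC. Qed.
Fact tp_mul1 : left_id (tp_trunc n (psC 1)) tp_mul.
Proof. by move=> a; rewrite -[a]tp_psK tp_mul_trunc mul1r. Qed.
Fact tp_mulD : left_distributive tp_mul +%R.
Proof.
move=> a b c; apply: tp_ext => k kn /=; rewrite kn -big_split /=.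
by apply: eq_bigr => i _; rewrite (leq_ltn_trans _ kn) ?mulrDl// -ltnS.
Qed.
HB.instance Definition _ :=
  GRing.Zmodule_isComPzRing.Build (tp n R) tp_mulA tp_mulC tp_mul1 tp_mulD.
End TpRing.

(* R((x)) x R[x]/(x^n) *)
Definition lp (n : nat) (R : comPzRingType) : comPzRingType :=
  (ls R * tp n R)%type.

Section Lp.
Variables (n : nat) (R : comPzRingType).

(* f |-> (f, [f]) *)
Definition ps_lp (f : ps R) : lp n R := (ps_ls f, tp_trunc n f).
Definition lpC (c : R) : lp n R := (lsC c, tp_trunc n (psC c)).

Fact lsC_additive : zmod_morphism (@lsC R).
Proof.
move=> a b; apply: lsP => m /=; rewrite /ls_monom.
by case: eqP => //; rewrite subr0.
Qed.
HB.instance Definition _ := GRing.isZmodMorphism.Build R (ls R) (@lsC R) lsC_additive.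

Fact lpC_additive : zmod_morphism lpC.
Proof.
move=> a b; congr (_, _); first exact: raddfB.
by apply: tp_ext => k kn /=; rewrite !kn; case: eqP => //; rewrite subr0.
Qed.
HB.instance Definition _ := GRing.isZmodMorphism.Build R (lp n R) lpC lpC_additive.
End Lp.
Arguments ps_lp n {R}.
Arguments lpC n {R}.

(* applies f to all coefficients *)
Definition lp_map n (R S : comPzRingType) (f : {additive R -> S}) (a : lp n R) :
  lp n S := (ls_map f a.1, tp_trunc n (ps_map f (tp_ps a.2))).

Section Lie.
Variables (F : fieldType) (g : vectType F) (br : g -> g -> g).

Record lie_bracket : Prop := LieBracket {
  lie_linearl : forall (c : F) x y z, br (c *: x + y) z = c *: br x z + br y z;
  lie_linearr : forall (c : F) x y z, br z (c *: x + y) = c *: br z x + br z y;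
  lie_alt : forall x, br x x = 0;
  lie_jacobi : forall x y z, br x (br y z) + br y (br z x) + br z (br x y) = 0
}.

Definition lie_ideal (I : {vspace g}) := forall x u, u \in I -> br x u \in I.

Record simple_lie : Prop := SimpleLie {
  simple_lie_bracket : lie_bracket;
  simple_lie_nonabelian : exists x y, br x y != 0;
  simple_lie_ideal : forall I : {vspace g}, lie_ideal I -> I = 0%VS \/ I = fullv
}.

(* tr (ad x o ad y) *)
Definition killing (x y : g) : F :=
  \tr (passmx.mxof (vbasis {:g}) (vbasis {:g}) (linfun (fun z => br x (br y z)))).
End Lie.

(* From here on b is a basis of g, and tensors are written in coordinates:  *)
(* for a commutative F-algebra C with structure map sc : F -> C,            *)
(*   X : 'rV[C]_d                  stands for sum b_i (x) X_i in g (x) C,     *)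
(*   T : 'M[C]_d                   for sum b_i (x) b_j (x) T_ij,            *)
(*   T : 'I_d -> 'I_d -> 'I_d -> C for sum b_i (x) b_j (x) b_k (x) T_ijk,   *)
(* so that Omega is 1%:M.  In particular g[[x]] is 'rV[ps F]_d,             *)
(* (g (x) g)[[x,y]] is 'M[ps (ps F)]_d and L_n is 'rV[lp n F]_d.            *)

Section Tensors.
Variables (F : fieldType) (g : vectType F) (br : g -> g -> g).
Variables (d : nat) (b : d.-tuple g).

(* [b_i, b_j] = sum_p strc i j p b_p *)
Definition strc (i j p : 'I_d) : F := coord b p (br b`_i b`_j).

Section Coefficients.
Variables (C : comPzRingType) (sc : F -> C).

Definition lie_br (X Y : 'rV[C]_d) : 'rV[C]_d :=
  \row_p \sum_i \sum_j sc (strc i j p) * X 0 i * Y 0 j.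

(* [X (x) 1 + 1 (x) Y, T] *)
Definition act2 (X Y : 'rV[C]_d) (T : 'M[C]_d) : 'M[C]_d :=
  \matrix_(p, q)
    (\sum_i \sum_j sc (strc i j p) * X 0 i * T j q
     + \sum_i \sum_j sc (strc i j q) * Y 0 i * T p j).

(* [X (x) 1 (x) 1 + 1 (x) Y (x) 1 + 1 (x) 1 (x) Z, T] *)
Definition act3 (X Y Z : 'rV[C]_d) (T : 'I_d -> 'I_d -> 'I_d -> C) :
    'I_d -> 'I_d -> 'I_d -> C := fun p q t =>
  \sum_i \sum_j sc (strc i j p) * X 0 i * T j q t
  + \sum_i \sum_j sc (strc i j q) * Y 0 i * T p j t
  + \sum_i \sum_j sc (strc i j t) * Z 0 i * T p q j.

(* [r12, r13] + [r12, r23] + [r13, r23] for r12 in g (x) g (x) 1,           *)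
(* r13 in g (x) 1 (x) g and r23 in 1 (x) g (x) g with coefficients in C.    *)
(* The commutators in U(g)^(x)3 (x) C are                                   *)
(* [u (x) v (x) 1, u' (x) 1 (x) w] = [u, u'] (x) v (x) w, and so on.        *)
Definition cyb3 (r12 r13 r23 : 'M[C]_d) : 'I_d -> 'I_d -> 'I_d -> C :=
  fun p q t =>
  \sum_i \sum_j sc (strc i j p) * r12 i q * r13 j t
  + \sum_i \sum_j sc (strc i j q) * r12 p i * r23 j t
  + \sum_i \sum_j sc (strc i j t) * r13 p i * r23 q j.
End Coefficients.

Let g1 := 'rV[ps F]_d.
Let g2 := 'M[ps (ps F)]_d.
Let g3 := 'I_d -> 'I_d -> 'I_d -> ps (ps (ps F)).
Let g4 := 'I_d -> 'I_d -> 'I_d -> 'I_d -> ps (ps (ps (ps F))).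

Definition psC2 (c : F) : ps (ps F) := psC (psC c).
Definition psC3 (c : F) : ps (ps (ps F)) := psC (psC2 c).

Definition brx : g1 -> g1 -> g1 := lie_br (@psC F).

(* [a(x) (x) 1 + 1 (x) a(y), T] *)
Definition adx2 (a : g1) : g2 -> g2 :=
  act2 psC2 (map_mx (@psC _) a) (map_mx (ps_map (@psC F)) a).

(* [a(x) (x) 1 (x) 1 + 1 (x) a(y) (x) 1 + 1 (x) 1 (x) a(z), T] *)
Definition adx3 (a : g1) : g3 -> g3 :=
  act3 psC3 (map_mx (fun f => psC (psC f)) a)
            (map_mx (fun f => psC (ps_map (@psC F) f)) a)
            (map_mx (ps_map psC2) a).

(* The coefficient of T at the tensor product over i < m of                 *)
(* b_(u i).1 x_i^(u i).2                                                    *)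
Definition coef2 (T : g2) (u : 'I_2 -> 'I_d * nat) : F :=
  let v k := u (inord k) in T (v 0).1 (v 1).1 (v 1).2 (v 0).2.
Definition coef3 (T : g3) (u : 'I_3 -> 'I_d * nat) : F :=
  let v k := u (inord k) in
  T (v 0).1 (v 1).1 (v 2).1 (v 2).2 (v 1).2 (v 0).2.
Definition coef4 (T : g4) (u : 'I_4 -> 'I_d * nat) : F :=
  let v k := u (inord k) in
  T (v 0).1 (v 1).1 (v 2).1 (v 3).1 (v 3).2 (v 2).2 (v 1).2 (v 0).2.

(* x_1 (x) .. (x) x_m |-> x_s(1) (x) .. (x) x_s(m), on coefficients:        *)
(* the factor x_j is moved to the place s^-1(j)                             *)
Definition perm_tens m (s : 'S_m) (T : ('I_m -> 'I_d * nat) -> F) :=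
  fun u : 'I_m -> 'I_d * nat => T (fun j => u ((s^-1)%g j)).

Definition skew_tens m (T : ('I_m -> 'I_d * nat) -> F) :=
  forall (s : 'S_m) u, perm_tens s T u = (-1) ^+ s * T u.

Definition Alt m (T : ('I_m -> 'I_d * nat) -> F) :=
  fun u => \sum_(s : 'S_m) (-1) ^+ s * perm_tens s T u.

(* (delta (x) 1) T and (delta (x) 1 (x) 1) T, extended by continuity:       *)
(* delta is applied to the coefficients, in g[[x]], of the monomials        *)
(* b_j y^l and b_j y^l (x) b_k z^m in the remaining tensor factors          *)
Definition delta1 (delta : g1 -> g2) (T : g2) : g3 := fun p q j =>
  Ps (fun l => delta (\row_i T i j l) p q).
Definition delta11 (delta : g1 -> g2) (T : g3) : g4 := fun p q j k =>
  Ps (fun m => Ps (fun l => delta (\row_i T i j k m l) p q)).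

(* delta (x^N g[[x]]) is in the M-th power of the ideal (x, y) for N large; *)
(* for linear maps this is continuity in the adic topologies                *)
Definition adic_continuous (delta : g1 -> g2) :=
  forall M : nat, exists N : nat, forall a : g1,
    (forall i k, (k < N)%N -> a 0 i k = 0) ->
    forall i j k l, (k + l < M)%N -> delta a i j l k = 0.

Record topological_quasi_lie_bialgebra (delta : g1 -> g2) (phi : g3) : Prop :=
  TopologicalQuasiLieBialgebra {
  tqlb_linear : forall (c : F) a a',
    delta (psC c *: a + a') = psC2 c *: delta a + delta a';
  tqlb_continuous : adic_continuous delta;
  tqlb_delta_skew : forall a, skew_tens (coef2 (delta a));
  tqlb_phi_skew : skew_tens (coef3 phi);
  tqlb_cocycle : forall a a',
    delta (brx a a') = adx2 a (delta a') - adx2 a' (delta a);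
  tqlb_cojacobi : forall a u,
    2%:R^-1 * Alt (coef3 (delta1 delta (delta a))) u = coef3 (adx3 a phi) u;
  tqlb_pentagon : forall u, Alt (coef4 (delta11 delta phi)) u = 0
}.

Section Manin.
Variable n : nat.
Let L := 'rV[lp n F]_d.

Definition brL : L -> L -> L := lie_br (@lpC n F).

(* a |-> (a, [a]), with image Delta *)
Definition diag (a : g1) : L := map_mx (ps_lp n) a.

(* a polynomial representative, as a Laurent series *)
Definition tp_ls (p : tp n F) : ls F := ps_ls (tp_ps p).

(* When alpha is in x^-n F[[x]] the residue of alpha p q only depends on    *)
(* the class of p q modulo x^n.                                             *)
Definition formL (alpha : ls F) (X Y : L) : F :=
  \sum_(i < d) \sum_(j < d) killing br b`_i b`_j *
    ls_res (alpha * ((X 0 i).1 * (Y 0 j).1 - tp_ls ((X 0 i).2 * (Y 0 j).2))).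

Definition lagrangian alpha (W : L -> Prop) :=
  forall X, W X <-> (forall Y, W Y -> formL alpha X Y = 0).

(* L_n is the direct sum of Delta and W *)
Definition complementary (W : L -> Prop) :=
  (forall X, exists a w, W w /\ X = diag a + w) /\
  (forall a, W (diag a) -> diag a = 0).

(* An element w of L_n is viewed as the functional a |-> B(diag a, w) on    *)
(* g[[x]].  contract2 alpha f T = (f (x) 1) T is the contraction of the     *)
(* first factor; pair2 and pair3 are <T, f (x) g> and <T, f (x) g (x) h>.   *)
Definition contract2 alpha (f : L) (T : g2) : g1 :=
  \row_j Ps (fun l => formL alpha (diag (\row_i T i j l)) f).
Definition contract3 alpha (f : L) (T : g3) : g2 :=
  \matrix_(j, k) Ps (fun m => Ps (fun l =>
    formL alpha (diag (\row_i T i j k m l)) f)).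
Definition pair2 alpha (T : g2) (f h : L) : F :=
  formL alpha (diag (contract2 alpha f T)) h.
Definition pair3 alpha (T : g3) (f h k : L) : F :=
  pair2 alpha (contract3 alpha f T) h k.

(* For f, h in W decompose [f, h] = p_1 + p_2 with p_1 = diag u and p_2 in  *)
(* W: delta is the map dual to p_2 and phi = - psi with                     *)
(* <f (x) h (x) k, psi> = B(k, p_1).                                        *)
Definition structure_of alpha (W : L -> Prop) (delta : g1 -> g2) (phi : g3) :=
  forall f h u v, W f -> W h -> W v -> brL f h = diag u + v ->
    (forall a, pair2 alpha (delta a) f h = formL alpha (diag a) v) /\
    (forall k, W k -> pair3 alpha phi f h k = - formL alpha k (diag u)).

(* (delta, phi) is given by a Lagrangian subspace of L(n, alpha)            *)
(* complementary to Delta, i.e. the Manin pair of (g[[x]], delta, phi) is   *)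
(* (L(n, alpha), Delta).  Not every structure is of this kind: delta = 0,   *)
(* phi = 0 has a degenerate Manin pair.                                     *)
Definition manin_pair_is alpha (delta : g1 -> g2) (phi : g3) :=
  exists W : L -> Prop,
    [/\ lagrangian alpha W, complementary W & structure_of alpha W delta phi].

(* (L_n (x) g)[[y]] is 'M[ps (lp n F)]_d: the       *)
(* coefficient f_(k,j) in L_n of b_j y^k is \row_i r i j k.                 *)

(* y^n / (x - y) *)
Definition kern : ps (lp n F) := Ps (fun k =>
  if (k < n)%N then (0, - tp_trunc n (psX F ^+ (n - 1 - k)))
  else (lsX F (n%:Z - 1 - k%:Z), 0)).

Definition emb2 (T : g2) : 'M[ps (lp n F)]_d := map_mx (ps_map (ps_lp n)) T.

(* s(x) y^n Omega / (x - y) *)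
Definition yang (s : ps F) : 'M[ps (lp n F)]_d := (psC (ps_lp n s) * kern)%:M.

Definition ns_type (s : ps F) (G : g2) : 'M[ps (lp n F)]_d := yang s + emb2 G.

(* tau(G(y,x)) *)
Definition tau_swap (G : g2) : g2 := \matrix_(i, j) ps_swap (G j i).

(* r = ns_type s G is skew-symmetric; h is the quotient                     *)
(* (s(x) y^n - s(y) x^n) / (x - y) in F[[x,y]]                              *)
Definition skew_series (s : ps F) (r : 'M[ps (lp n F)]_d) :=
  exists G h,
    [/\ r = ns_type s G,
        (psC (psX F) - psX (ps F)) * h =
          psC s * psX (ps F) ^+ n - ps_map (@psC F) s * psC (psX F ^+ n)
      & r = yang s - emb2 h%:M - emb2 (tau_swap G)].

(* span of the f_(k,j) *)
Definition span_series (r : 'M[ps (lp n F)]_d) : L -> Prop := fun w =>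
  exists (N : nat) (c : nat -> 'I_d -> F),
    w = \sum_(k < N) \sum_j lpC n (c k j) *: (\row_i r i j k).

(* [a (x) 1 + 1 (x) a, r] in (L_n (x) g)[[y]] *)
Definition ad_series (a : g1) : 'M[ps (lp n F)]_d -> 'M[ps (lp n F)]_d :=
  act2 (fun c => psC (lpC n c)) (map_mx (fun f => psC (ps_lp n f)) a)
       (map_mx (ps_map (lpC n)) a).

Let A1 := lp n F.
Let A2 := lp n A1.
Let A3 := lp n A2.

(* CYB(r) in g^(x)3 (x) A_3: for r = sum f_(k,j) (x) b_j y^k,               *)
(* r12 = sum f(x_1) (x) b x_2^k (x) 1, r13 = sum f(x_1) (x) 1 (x) b x_3^k,  *)
(* r23 = sum 1 (x) f(x_2) (x) b x_3^k                                       *)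
Definition cyb_lp (r : 'M[ps A1]_d) : 'I_d -> 'I_d -> 'I_d -> A3 :=
  cyb3 (fun c => lpC n (lpC n (lpC n c)))
    (map_mx (fun f : ps A1 => lpC n (ps_lp n f) : A3) r)
    (map_mx (fun f : ps A1 => ps_lp n (ps_map (lpC n) f) : A3) r)
    (map_mx (fun f : ps A1 => ps_lp n (ps_map (lp_map (lpC n)) f) : A3) r).

(* F[[x,y,z]] in A_3 *)
Definition emb3 (f : ps (ps (ps F))) : A3 :=
  ps_lp n (ps_map (fun f' => ps_lp n (ps_map (ps_lp n) f')) f).

(* r read in (g (x) g)((x))[[y]] *)
Definition laurent (r : 'M[ps A1]_d) : 'M[ps (ls F)]_d :=
  map_mx (ps_map (fun f : A1 => f.1)) r.
End Manin.

Definition emb2_ls (T : g2) : 'M[ps (ls F)]_d := map_mx (ps_map (@ps_ls F)) T.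

Definition ad_ls (a : g1) : 'M[ps (ls F)]_d -> 'M[ps (ls F)]_d :=
  act2 (fun c => psC (lsC c)) (map_mx (fun f => psC (ps_ls f)) a)
       (map_mx (ps_map (@lsC F)) a).

Definition cyb_ls (r : 'M[ps (ls F)]_d) :
    'I_d -> 'I_d -> 'I_d -> ps (ls (ls F)) :=
  cyb3 (fun c => psC (lsC (lsC c)))
    (map_mx (fun f => psC (ps_ls f)) r)
    (map_mx (ps_map (@lsC (ls F))) r)
    (map_mx (ps_map (ls_map (@lsC F))) r).

Definition emb3_ls (f : ps (ps (ps F))) : ps (ls (ls F)) :=
  ps_map (fun f' => ps_ls (ps_map (@ps_ls F) f')) f.

(* a series together with its type (n, s) *)
Record series := Series {
  ser_n : nat;
  ser_s : ps F;
  ser_r : 'M[ps (lp ser_n F)]_d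
}.

Definition ps_unit (s : ps F) := exists t, s * t = 1.

Definition skew_ns_series (x : series) :=
  ps_unit (ser_s x) /\ skew_series (ser_s x) (ser_r x).

(* s = 1 / (x^n alpha); alpha has leading term x^-n / s(0), so the           *)
(* normalization alpha = x^-n + .. amounts to s(0) = 1                      *)
Definition is_alpha (n : nat) (s : ps F) (alpha : ls F) :=
  lsX F n%:Z * alpha * ps_ls s = 1.

Definition corresponds (x : series) (delta : g1 -> g2) (phi : g3) :=
  exists alpha, let W := span_series (ser_r x) in
    [/\ is_alpha (ser_n x) (ser_s x) alpha, lagrangian alpha W,
        complementary W & structure_of alpha W delta phi].

End Tensors.

(* Main.v *)
Require Import Defs.
From mathcomp Require Import all_boot all_order all_algebra all_fingroup.
From mathcomp Require Import finmap boolp fsbigop zify.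
From HB Require Import structures.

(** The form of L(n, alpha) pairs the coefficients f_(k,j) of a series
    r = sum f_(k,j) (x) b_j y^k of type (n, s) with the b_i x^l as a dual basis:
    alpha s = x^-n, and the residue of x^(-n) x^l x^(n-1-k) is 1 if k = l and 0
    otherwise ([lp_res_kern]). A Laurent series is bounded below and Delta is
    its own orthogonal, so every vector of L_n is a vector of Delta plus a finite
    combination of the f_(k,j) ([projW_span]): their span W is a complement of
    Delta. The pairings of the f_(k,j) with one another are the coefficients of
    g + tau(g(y,x)) + (s(x) y^n - s(y) x^n) Omega / (x - y), so that r is
    skew-symmetric exactly when W is isotropic, hence Lagrangian
    ([skew_series_iso]). Conversely, for a Lagrangian complement W, the
    components in W of the coefficients of s(x) y^n Omega / (x - y) are the
    coefficients of the series ([series_of_lagrangian]).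

    As B vanishes on Delta and on W, the structure is given without projections:
    the pairing of delta(a) with f (x) h is B(a, [f, h]), and that of phi with
    f (x) h (x) k is - B([f, h], k). In the axioms, brackets that are projected
    to W then occur inside B, and once the alternations are reduced to cyclic
    sums ([Alt_cyclic], [Alt4_eq0]) they can be grouped in pairs
    B(X, P Y) + B(Y, P X) = B(X, Y); what is left are Jacobi identities
    ([split_cocycle], [split_cojacobi], [split_pentagon]).

    For the bracket identity, a coefficient in y of [a (x) 1 + 1 (x) a, r] is
    orthogonal to Delta by invariance, hence lies in Delta, and its pairings
    with the f_(k,j) are coefficients of - delta(a) ([ad_series_delta]). For
    CYB(r), contract the first factor with X in L_n: r contracts to the
    projection of X to Delta, the third commutator to an element of W, and the
    two cases X in W and X in Delta together give - phi ([cyb_ps_phi]).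

    Projecting L_n to its first component is a ring morphism on coefficients, so
    the identities persist for Laurent series. Nothing is lost: n and s are read
    off the polar part ([laurent_inj]). Moreover delta alone determines the
    Laurent series, and hence the type (n, s), because a tensor killed by all of
    g[[x]] is 0 ([ad_ls_inj]). *)

Set Implicit Arguments.
Unset Strict Implicit.
Unset Printing Implicit Defensive.

Import GRing.Theory.
Local Open Scope ring_scope.

(** * The Killing form and the structure constants *)

Section KillingForm.
Variables (F : fieldType) (g : vectType F) (br : g -> g -> g).
Hypothesis brP : lie_bracket br.

Definition ad_lin x := linfun (br x : g -> g).

Lemma ad_linE x y : ad_lin x y = br x y.
Proof.
pose m := GRing.isLinear.Build F g g *:%R (br x)
  (fun c y z => lie_linearr brP c y z x).
pose f : {linear g -> g} := HB.pack (br x) m.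
by rewrite /ad_lin (lfunE f).
Qed.

Lemma br_skew x y : br x y = - br y x.
Proof.
have brDl u v w : br (u + v) w = br u w + br v w.
  by have := lie_linearl brP 1 u v w; rewrite !scale1r.
have brDr u v w : br w (u + v) = br w u + br w v.
  by have := lie_linearr brP 1 u v w; rewrite !scale1r.
have := lie_alt brP (x + y).
rewrite brDl !brDr !(lie_alt brP) add0r addr0 => /eqP.
by rewrite addr_eq0 => /eqP.
Qed.

Lemma killingE x y :
  killing br x y = \tr (passmx.mxof (vbasis {:g}) (vbasis {:g}) (ad_lin x) *m
                        passmx.mxof (vbasis {:g}) (vbasis {:g}) (ad_lin y)).
Proof.
rewrite mxtrace_mulC -(passmx.mxof_comp _ _ (vbasisP _)).
rewrite /killing; congr (\tr (passmx.mxof _ _ _)).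
have E : (fun z => br x (br y z)) = (ad_lin x \o ad_lin y)%VF.
  by apply/funext => z; rewrite lfunE /= !ad_linE.
by rewrite E; apply/lfunP => z; rewrite lfunE.
Qed.

Lemma killingC x y : killing br x y = killing br y x.
Proof. by rewrite !killingE mxtrace_mulC. Qed.

Lemma ad_lin_linear c x y : ad_lin (c *: x + y) = c *: ad_lin x + ad_lin y.
Proof.
apply/lfunP => z; rewrite !(add_lfunE, scale_lfunE) !ad_linE.
exact: lie_linearl.
Qed.

Lemma killing_linear c x y z :
  killing br (c *: x + y) z = c * killing br x z + killing br y z.
Proof.
by rewrite !killingE ad_lin_linear passmx.mxof_linear mulmxDl -scalemxAl linearP.
Qed.

Lemma ad_lin_br x y :
  ad_lin (br x y) = (ad_lin x \o ad_lin y)%VF - (ad_lin y \o ad_lin x)%VF.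
Proof.
apply/lfunP => z; rewrite add_lfunE opp_lfunE !comp_lfunE !ad_linE.
have := lie_jacobi brP x y z; rewrite (br_skew z (br x y)) (br_skew z x).
have -> : br y (- br x z) = - br y (br x z) by rewrite -!ad_linE linearN.
by move/eqP; rewrite subr_eq0 => /eqP.
Qed.

Lemma killing_invariant x y z : killing br (br x y) z = killing br x (br y z).
Proof.
have e := @vbasisP _ _ {:g}; have fr := basis_free e.
have mxofB u v : passmx.mxof (vbasis {:g}) (vbasis {:g}) (u - v) =
    passmx.mxof (vbasis {:g}) (vbasis {:g}) u -
    passmx.mxof (vbasis {:g}) (vbasis {:g}) v.
  by rewrite addrC -scaleN1r passmx.mxof_linear scaleN1r addrC.
rewrite !killingE !ad_lin_br !mxofB mulmxBl mulmxBr !raddfB /=.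
rewrite !(passmx.mxof_comp _ _ e) -!mulmxA; congr (_ - _).
by rewrite mxtrace_mulC -mulmxA.
Qed.

Lemma killing_center x y : (forall z, br x z = 0) -> killing br x y = 0.
Proof.
move=> x0; rewrite killingE; have -> : ad_lin x = 0.
  by apply/lfunP => z; rewrite ad_linE x0 zero_lfunE.
have e := @vbasisP _ _ {:g}; have fr := basis_free e.
have /eqP -> : passmx.mxof (vbasis {:g}) (vbasis {:g}) (0 : 'End(g)) == 0.
  by rewrite passmx.mxof_eq0.
by rewrite mul0mx raddf0.
Qed.
End KillingForm.

Section StructureConstants.
Variables (F : fieldType) (g : vectType F) (br : g -> g -> g).
Variables (d : nat) (b : d.-tuple g).
Hypothesis brP : lie_bracket br.
Hypothesis b_basis : basis_of fullv b.
Hypothesis b_orth : forall i j : 'I_d, killing br b`_i b`_j = (i == j)%:R.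
Notation c := (strc br b).

Lemma coord_killing p v : coord b p v = killing br v b`_p.
Proof.
have kD x y z : killing br (x + y) z = killing br x z + killing br y z.
  by have := killing_linear brP 1 x y z; rewrite scale1r mul1r.
have k0 z : killing br 0 z = 0.
  by apply: (@addrI _ (killing br 0 z)); rewrite -kD !addr0.
rewrite {2}(coord_basis b_basis (memvf v)).
rewrite (big_morph (fun x => killing br x b`_p) (fun x y => kD x y _) (k0 _)).
rewrite (bigD1 p) //= big1 ?addr0 => [|i /negbTE ip].
  by rewrite -[_ *: _]addr0 (killing_linear brP) b_orth eqxx mulr1 k0 addr0.
by rewrite -[_ *: _]addr0 (killing_linear brP) b_orth ip mulr0 k0 addr0.
Qed.

Lemma strc_skew i j p : c i j p = - c j i p.
Proof. by rewrite /strc (br_skew brP) raddfN. Qed.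

Lemma strc_cyclic i j p : c i j p = c j p i.
Proof.
by rewrite /strc !coord_killing killing_invariant // killingC.
Qed.

Lemma strc_jacobi i j k p :
  \sum_m (c j k m * c i m p + c k i m * c j m p + c i j m * c k m p) = 0.
Proof.
have E (u v w : 'I_d) : coord b p (br b`_u (br b`_v b`_w)) = \sum_m c v w m * c u m p.
  rewrite (coord_basis b_basis (memvf (br b`_v b`_w))) -(ad_linE brP) !linear_sum.
  by apply: eq_bigr => m _; rewrite !linearZ /= ad_linE.
rewrite !big_split /= -!E -!raddfD /=.
by rewrite (lie_jacobi brP) raddf0.
Qed.

(** The nondegeneracy of the Killing form on an orthonormal basis leaves no
    room for a centre. *)
Lemma strc_center (Y : 'I_d -> F) :
  (forall i p, \sum_j c i j p * Y j = 0) -> forall j, Y j = 0.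
Proof.
move=> Y0 j; pose v := \sum_k Y k *: b`_k.
have fr := basis_free b_basis.
have -> : Y j = coord b j v by rewrite /v coord_sum_free.
rewrite coord_killing; apply: (killing_center brP) => z.
rewrite (br_skew brP) -(ad_linE brP); apply/eqP; rewrite oppr_eq0; apply/eqP.
suff: ad_lin br v = 0.
  move=> v0; rewrite ad_linE // (br_skew brP) -ad_linE // v0 zero_lfunE.
  by rewrite oppr0.
apply/lfunP => w; rewrite zero_lfunE ad_linE //.
rewrite (coord_basis b_basis (memvf w)) -(ad_linE brP) linear_sum big1 // => i _.
rewrite linearZ /= (ad_linE brP) (br_skew brP) -(ad_linE brP) linear_sum /=.
rewrite (coord_basis b_basis (memvf (\sum_i0 _))) big1 ?oppr0 ?scaler0 // => p _.
rewrite linear_sum /= (eq_bigr (fun k => c i k p * Y k)) ?Y0 ?scale0r // => k _.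
by rewrite !linearZ /= (ad_linE brP) mulrC.
Qed.
End StructureConstants.

(** * Rings of formal series and their morphisms *)

Lemma mxZE (V : pzSemiRingType) m n (x : V) (A : 'M[V]_(m, n)) i j :
  (x *: A) i j = x * A i j.
Proof. by rewrite mxE. Qed.

Lemma mxDE (V : nmodType) m n (A B : 'M[V]_(m, n)) i j :
  (A + B) i j = A i j + B i j.
Proof. by rewrite mxE. Qed.

Section Coefficients.
Variable R : zmodType.

Lemma ps_sumE I (r : seq I) P (G : I -> ps R) k :
  (\sum_(i <- r | P i) G i) k = \sum_(i <- r | P i) G i k.
Proof. by apply: (big_morph (fun a : ps R => a k)). Qed.

Lemma ls_sumE I (r : seq I) P (G : I -> ls R) m :
  (\sum_(i <- r | P i) G i) m = \sum_(i <- r | P i) G i m.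
Proof. by apply: (big_morph (fun a : ls R => a m)). Qed.

Lemma psDE (a b : ps R) k : (a + b) k = a k + b k.
Proof. by []. Qed.

Lemma psBE (a b : ps R) k : (a - b) k = a k - b k.
Proof. by []. Qed.

Lemma lsBE (a b : ls R) m : (a - b) m = a m - b m.
Proof. by []. Qed.

Lemma tpDE n (a b : tp n R) k : (a + b) k = a k + b k.
Proof. by rewrite /=; case: ltnP => // nk; rewrite !tp_bnd // addr0. Qed.

Lemma tpNE n (a : tp n R) k : (- a) k = - a k.
Proof. by rewrite /=; case: ltnP => // nk; rewrite tp_bnd // oppr0. Qed.

Lemma tp0E n k : (0 : tp n R) k = 0.
Proof. by rewrite /=; case: ltnP. Qed.

Lemma tp_sumE n I (r : seq I) P (G : I -> tp n R) k :
  (\sum_(i <- r | P i) G i) k = \sum_(i <- r | P i) G i k.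
Proof.
apply: (big_morph (fun a : tp n R => a k)) => [a b|]; first exact: tpDE.
exact: tp0E.
Qed.

Lemma tp_truncE n (f : ps R) k :
  tp_trunc n f k = if (k < n)%N then f k else 0.
Proof. by []. Qed.

Fact tp_trunc_additive n : zmod_morphism (@tp_trunc n R).
Proof. by move=> a b; apply: tp_ext => k kn; rewrite tpDE tpNE /= kn. Qed.
HB.instance Definition _ n :=
  GRing.isZmodMorphism.Build (ps R) (tp n R) (@tp_trunc n R)
    (tp_trunc_additive n).
End Coefficients.

Section Multiplication.
Variable R : comPzRingType.

Lemma psME (a b : ps R) k : (a * b) k = \sum_(i < k.+1) a i * b (k - i)%N.
Proof. by []. Qed.

Lemma psC_mulE x (a : ps R) k : (psC x * a) k = x * a k.
Proof.
rewrite psME big_ord_recl /= subn0 big1 ?addr0 // => i _.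
by rewrite mul0r.
Qed.

Fact psC_additive : zmod_morphism (@psC R).
Proof. by move=> x y; apply: psP => -[|k] //=; rewrite subr0. Qed.
Fact psC_monoid : monoid_morphism (@psC R).
Proof.
split=> // x y; apply: psP => k; rewrite psC_mulE /=.
by case: k => [|k] //=; rewrite mulr0.
Qed.
HB.instance Definition _ := GRing.isZmodMorphism.Build R (ps R) _ psC_additive.
HB.instance Definition _ := GRing.isMonoidMorphism.Build R (ps R) _ psC_monoid.

Lemma psX_mulE (a : ps R) k : (psX R * a) k = if k is k'.+1 then a k' else 0.
Proof.
rewrite psME big_ord_recl /= mul0r add0r; case: k => [|k].
  by rewrite big_ord0.
rewrite big_ord_recl /= mul1r subn1 big1 ?addr0 // => i _.
by rewrite mul0r.
Qed.

Lemma psXn_mulE m (a : ps R) k :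
  (psX R ^+ m * a) k = if (m <= k)%N then a (k - m)%N else 0.
Proof.
elim: m k => [|m IH] k; first by rewrite expr0 mul1r subn0.
by rewrite exprS -mulrA psX_mulE; case: k => [|k] //; rewrite IH ltnS subSS.
Qed.

Lemma psXnE m k : (psX R ^+ m) k = (k == m)%:R.
Proof.
rewrite -[_ ^+ _]mulr1 psXn_mulE /= subn_eq0; case: leqP => mk.
  by rewrite eqn_leq mk andbT; case: leqP.
by rewrite ltn_eqF.
Qed.

Lemma lsM_mulE x e (u : ls R) m : (lsM x e * u) m = x * u (m - e).
Proof.
rewrite [LHS]/(ls_conv (ls_monom x e) u m) /ls_conv.
rewrite (fsbigTE [fset e]%fset) ?big_seq_fset1 /ls_monom ?eqxx // => i.
by rewrite in_fset1 => /negbTE ->; rewrite mul0r.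
Qed.

Lemma lsX_mulE e (u : ls R) m : (lsX R e * u) m = u (m - e).
Proof. by rewrite lsM_mulE mul1r. Qed.

Lemma lsXD e e' : lsX R e * lsX R e' = lsX R (e + e').
Proof.
apply: lsP => m; rewrite lsX_mulE /= /ls_monom.
by congr (if _ then _ else _); apply/eqP/eqP; lia.
Qed.

Lemma lsX0 : lsX R 0 = 1.
Proof. by apply: lsP => m. Qed.

Fact lsC_monoid : monoid_morphism (@lsC R).
Proof.
split=> [|x y]; apply: lsP => m //; rewrite lsM_mulE subr0 /= /ls_monom.
by case: eqP; rewrite ?mulr0.
Qed.
HB.instance Definition _ := GRing.isMonoidMorphism.Build R (ls R) _ lsC_monoid.

Fact ps_ls_additive : zmod_morphism (@ps_ls R).
Proof. by move=> a b; apply: lsP => -[] k //=; rewrite subr0. Qed.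
Fact ps_ls_monoid : monoid_morphism (@ps_ls R).
Proof.
split=> [|a b]; first by apply: lsP => -[].
have bnd (u : ps R) (i : int) : i < - 0%:Z -> ps_ls_fun u i = 0 by case: i.
apply: lsP => -[] k; last by apply/esym/(ls_conv_small (bnd a) (bnd b)); lia.
transitivity (ls_conv (ps_ls_fun a) (ps_ls_fun b) (Posz k)) => //.
rewrite (ls_convE (K := k) (bnd a) (bnd b)); last by lia.
rewrite [LHS]psME; apply: eq_bigr => i _.
have -> : Posz k - (Posz i - 0) = (k - i)%N by have := ltn_ord i; lia.
by rewrite subr0.
Qed.
HB.instance Definition _ :=
  GRing.isZmodMorphism.Build (ps R) (ls R) _ ps_ls_additive.
HB.instance Definition _ :=
  GRing.isMonoidMorphism.Build (ps R) (ls R) _ ps_ls_monoid.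

Lemma ps_lsM (a b : ps R) : ps_ls (a * b) = ps_ls a * ps_ls b.
Proof. exact: rmorphM. Qed.

Lemma ps_lsXn m : ps_ls (psX R ^+ m) = lsX R m%:Z.
Proof.
apply: lsP => -[] k //=; rewrite psXnE /ls_monom.
by rewrite -[Posz k == Posz m]/(k == m); case: eqP.
Qed.

Fact tp_trunc_monoid n : monoid_morphism (@tp_trunc n R).
Proof. by split=> // a b; rewrite -tp_mul_trunc. Qed.
HB.instance Definition _ n :=
  GRing.isMonoidMorphism.Build (ps R) (tp n R) _ (tp_trunc_monoid n).

Lemma tp_truncM n (a b : ps R) :
  tp_trunc n (a * b) = tp_trunc n a * tp_trunc n b.
Proof. exact: rmorphM. Qed.

Lemma tp_truncN n (a : ps R) : tp_trunc n (- a) = - tp_trunc n a.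
Proof. exact: raddfN. Qed.

Fact ps_lp_additive n : zmod_morphism (@ps_lp n R).
Proof. by move=> a b; congr (_, _); rewrite raddfB. Qed.
Fact ps_lp_monoid n : monoid_morphism (@ps_lp n R).
Proof. by split=> [|a b]; congr (_, _); rewrite ?rmorph1 ?rmorphM. Qed.
HB.instance Definition _ n :=
  GRing.isZmodMorphism.Build (ps R) (lp n R) _ (ps_lp_additive n).
HB.instance Definition _ n :=
  GRing.isMonoidMorphism.Build (ps R) (lp n R) _ (ps_lp_monoid n).

Lemma ps_lpC n (x : R) : ps_lp n (psC x) = lpC n x.
Proof. by congr (_, _); apply: lsP => -[] [|k]. Qed.

Fact lpC_monoid n : monoid_morphism (@lpC n R).
Proof. by split=> [|x y]; rewrite -!ps_lpC ?rmorph1 // !rmorphM. Qed.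
HB.instance Definition _ n :=
  GRing.isMonoidMorphism.Build R (lp n R) _ (lpC_monoid n).

Lemma ps_ls_inj : injective (@ps_ls R).
Proof.
by move=> a b ab; apply: psP => k; have := congr1 (fun u : ls R => u k) ab.
Qed.

Lemma ps_lp_inj n : injective (@ps_lp n R).
Proof. by move=> a b /(congr1 fst)/ps_ls_inj. Qed.
End Multiplication.

Lemma ps_mapE (R S : Type) (f : R -> S) (a : ps R) k : ps_map f a k = f (a k).
Proof. by []. Qed.

Section Maps.
Variables (R S : comPzRingType).

Fact ps_map_additive (f : {additive R -> S}) : zmod_morphism (ps_map f).
Proof. by move=> a b; apply: psP => k /=; rewrite raddfB. Qed.
HB.instance Definition _ (f : {additive R -> S}) :=
  GRing.isZmodMorphism.Build (ps R) (ps S) (ps_map f) (ps_map_additive f).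

Lemma ps_map_psC (f : {additive R -> S}) x : ps_map f (psC x) = psC (f x).
Proof. by apply: psP => -[|k] //=; rewrite raddf0. Qed.

Fact ps_map_monoid (f : {rmorphism R -> S}) : monoid_morphism (ps_map f).
Proof.
split=> [|a b]; apply: psP => k.
  by rewrite /= (fun_if f) rmorph1 rmorph0.
by rewrite psME /= rmorph_sum; apply: eq_bigr => i _; rewrite rmorphM.
Qed.
HB.instance Definition _ (f : {rmorphism R -> S}) :=
  GRing.isMonoidMorphism.Build (ps R) (ps S) (ps_map f) (ps_map_monoid f).

Fact ls_map_additive (f : {additive R -> S}) : zmod_morphism (ls_map f).
Proof. by move=> a b; apply: lsP => k /=; rewrite raddfB. Qed.
HB.instance Definition _ (f : {additive R -> S}) :=
  GRing.isZmodMorphism.Build (ls R) (ls S) (ls_map f) (ls_map_additive f).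

(** Both sides of a twisted product rule are finite convolutions; the rule
    covers a ring morphism as well as a map linear over a subring. *)
Lemma ls_map_mul (T : comPzRingType) (f : {additive R -> S})
    (h : {additive R -> S}) (s : {additive T -> R}) (s' : {additive T -> S}) :
  (forall x y, f (x * s y) = h x * s' y) ->
  forall (u : ls R) (v : ls T),
    ls_map f (u * ls_map s v) = ls_map h u * ls_map s' v.
Proof.
move=> fh u v; apply: lsP => m; case: u v => [u [N uN]] [v [M vM]] /=.
have hN (i : int) : i < - N%:Z -> h (u i) = 0 by move/uN ->; rewrite raddf0.
have sM (i : int) : i < - M%:Z -> s (v i) = 0 by move/vM ->; rewrite raddf0.
have s'M (i : int) : i < - M%:Z -> s' (v i) = 0 by move/vM ->; rewrite raddf0.
have mK : m + N%:Z + M%:Z <= (absz (m + N%:Z + M%:Z))%:Z by lia.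
rewrite (ls_convE uN sM mK) (ls_convE hN s'M mK) raddf_sum.
by apply: eq_bigr => i _; rewrite fh.
Qed.

Fact ls_map_monoid (f : {rmorphism R -> S}) : monoid_morphism (ls_map f).
Proof.
split=> [|a b].
  by apply: lsP => m; rewrite /= /ls_monom (fun_if f) rmorph1 rmorph0.
have := @ls_map_mul R f f idfun f (fun x y => rmorphM f x y) a b.
by have -> : ls_map idfun b = b by apply: lsP.
Qed.
HB.instance Definition _ (f : {rmorphism R -> S}) :=
  GRing.isMonoidMorphism.Build (ls R) (ls S) (ls_map f) (ls_map_monoid f).

Lemma lp_map_mul n (T : comPzRingType) (f : {additive R -> S})
    (h : {additive R -> S}) (s : {additive T -> R}) (s' : {additive T -> S}) :
  (forall x y, f (x * s y) = h x * s' y) ->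
  forall (u : lp n R) (v : lp n T),
    lp_map f (u * lp_map s v) = lp_map h u * lp_map s' v.
Proof.
move=> fh u v; congr (_, _); first exact: ls_map_mul.
apply: tp_ext => k kn; rewrite /= !kn raddf_sum; apply: eq_bigr => i _.
have ki : (k - i < n)%N by rewrite (leq_ltn_trans _ kn) // leq_subr.
have ii : (i < n)%N by rewrite (leq_ltn_trans _ kn) // -ltnS.
by rewrite /= ki ii.
Qed.

Fact lp_map_additive n (f : {additive R -> S}) :
  zmod_morphism (lp_map f : lp n R -> lp n S).
Proof.
move=> a b; congr (_, _); first exact: (raddfB (ls_map f)).
apply: tp_ext => k kn; rewrite tpDE tpNE !tp_truncE kn.
rewrite -[RHS]/(f _ - f _) -raddfB; congr (f _).
exact: etrans (tpDE _ _ _) (congr1 _ (tpNE _ _)).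
Qed.
HB.instance Definition _ n (f : {additive R -> S}) :=
  GRing.isZmodMorphism.Build (lp n R) (lp n S) (lp_map f) (lp_map_additive f).

Fact lp_map_monoid n (f : {rmorphism R -> S}) :
  monoid_morphism (lp_map f : lp n R -> lp n S).
Proof.
have mulP (a b : lp n R) : lp_map f (a * b) = lp_map f a * lp_map f b.
  have := @lp_map_mul n R f f idfun f (fun x y => rmorphM f x y) a b.
  have -> : lp_map idfun b = b.
    case: b => u p; congr (_, _); first exact: lsP.
    by apply: tp_ext => k kn /=; rewrite kn.
  by [].
split=> //; congr (_, _); first exact: rmorph1.
by apply: tp_ext => -[|k] kn; rewrite /= !kn ?rmorph1 ?rmorph0.
Qed.
HB.instance Definition _ n (f : {rmorphism R -> S}) :=
  GRing.isMonoidMorphism.Build (lp n R) (lp n S) (lp_map f) (lp_map_monoid n f).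

Lemma lp_map_ps n (f : {additive R -> S}) (a : ps R) :
  lp_map f (ps_lp n a) = ps_lp n (ps_map f a).
Proof.
congr (_, _); first by apply: lsP => -[] k //=; rewrite raddf0.
by apply: tp_ext => k kn; rewrite /= !kn.
Qed.

Lemma lp_mapC n (f : {additive R -> S}) x : lp_map f (lpC n x) = lpC n (f x).
Proof. by rewrite -!ps_lpC lp_map_ps ps_map_psC. Qed.
End Maps.

Section Components.
Variables (n : nat) (R : comPzRingType).

Lemma lpC_mul1 x (u : lp n R) m : (lpC n x * u).1 m = x * u.1 m.
Proof. by rewrite -[LHS]/((lsC x * u.1) m) lsM_mulE subr0. Qed.

Lemma lpC_mul2 x (u : lp n R) k : (lpC n x * u).2 k = x * u.2 k.
Proof.
rewrite -[LHS]/((tp_trunc n (psC x) * u.2) k) -[u.2]tp_psK -tp_truncM !tp_truncE.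
by rewrite psC_mulE; case: ifP; rewrite ?mulr0.
Qed.

Lemma lp_sum1 I (r : seq I) (G : I -> lp n R) :
  (\sum_(i <- r) G i).1 = \sum_(i <- r) (G i).1.
Proof. by apply: (big_morph (fun u : lp n R => u.1)). Qed.

Lemma lp_sum2 I (r : seq I) (G : I -> lp n R) :
  (\sum_(i <- r) G i).2 = \sum_(i <- r) (G i).2.
Proof. by apply: (big_morph (fun u : lp n R => u.2)). Qed.

Lemma lpP (u v : lp n R) : u.1 =1 v.1 -> u.2 =1 v.2 -> u = v.
Proof. by case: u v => [a p] [a' p'] /= /lsP -> /tpP ->. Qed.

Definition lp_fst (u : lp n R) : ls R := u.1.

Fact lp_fst_additive : zmod_morphism lp_fst.
Proof. by []. Qed.
Fact lp_fst_monoid : monoid_morphism lp_fst.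
Proof. by split. Qed.
HB.instance Definition _ :=
  GRing.isZmodMorphism.Build (lp n R) (ls R) lp_fst lp_fst_additive.
HB.instance Definition _ :=
  GRing.isMonoidMorphism.Build (lp n R) (ls R) lp_fst lp_fst_monoid.
End Components.

(** * The Lie algebra over a commutative ring *)

Section LieOverRing.
Variables (F : fieldType) (g : vectType F) (br : g -> g -> g).
Variables (d : nat) (b : d.-tuple g).
Hypothesis brP : lie_bracket br.
Hypothesis b_basis : basis_of fullv b.
Hypothesis b_orth : forall i j : 'I_d, killing br b`_i b`_j = (i == j)%:R.
Variables (C : comPzRingType) (sc : {rmorphism F -> C}).
Notation c := (strc br b).
Notation "[ X , Y ]" := (lie_br br b sc X Y) : ring_scope.

Definition dot (X Y : 'rV[C]_d) : C := \sum_i X 0 i * Y 0 i.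

Lemma lie_brDl X X' Y : [X + X', Y] = [X, Y] + [X', Y].
Proof.
apply/rowP => p; rewrite !mxE -big_split; apply: eq_bigr => i _ /=.
rewrite -big_split; apply: eq_bigr => j _ /=.
by rewrite mxE mulrDr mulrDl.
Qed.

Lemma lie_brZl x X Y : [x *: X, Y] = x *: [X, Y].
Proof.
apply/rowP => p; rewrite !mxE mulr_sumr; apply: eq_bigr => i _ /=.
rewrite mulr_sumr; apply: eq_bigr => j _ /=.
by rewrite mxE !mulrA (mulrC x).
Qed.

Lemma lie_br_skew X Y : [X, Y] = - [Y, X].
Proof.
apply/rowP => p; rewrite !mxE exchange_big -sumrN; apply: eq_bigr => i _ /=.
rewrite -sumrN; apply: eq_bigr => j _ /=.
by rewrite (strc_skew b brP) rmorphN !mulNr mulrAC.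
Qed.

Lemma lie_brDr X Y Y' : [X, Y + Y'] = [X, Y] + [X, Y'].
Proof. by rewrite lie_br_skew lie_brDl opprD -!(lie_br_skew X). Qed.

Lemma lie_brNl X Y : [- X, Y] = - [X, Y].
Proof. by rewrite -scaleN1r lie_brZl scaleN1r. Qed.

Lemma lie_br_br X Y Z p : [X, [Y, Z]] 0 p =
  \sum_i \sum_j \sum_k
     X 0 i * Y 0 j * Z 0 k * sc (\sum_m c j k m * c i m p).
Proof.
rewrite mxE; apply: eq_bigr => i _.
under eq_bigr => m _ do rewrite mxE mulr_sumr.
rewrite exchange_big; apply: eq_bigr => j _ /=.
under eq_bigr => m _ do rewrite mulr_sumr.
rewrite exchange_big; apply: eq_bigr => k _ /=.
rewrite rmorph_sum mulr_sumr; apply: eq_bigr => m _ /=.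
rewrite rmorphM [sc _ * X 0 i]mulrC -!mulrA; congr (_ * _).
by rewrite mulrA [RHS]mulrA [RHS]mulrC [sc _ * sc _]mulrC.
Qed.

Lemma lie_br_jacobi X Y Z : [X, [Y, Z]] + [Y, [Z, X]] + [Z, [X, Y]] = 0.
Proof.
have rot (G : 'I_d -> 'I_d -> 'I_d -> C) :
    \sum_j \sum_k \sum_i G j k i = \sum_i \sum_j \sum_k G j k i.
  rewrite [RHS]exchange_big; apply: eq_bigr => j _.
  by rewrite exchange_big.
have mxD (U V : 'rV[C]_d) p : (U + V) 0 p = U 0 p + V 0 p by rewrite mxE.
apply/rowP => p; rewrite !mxD !lie_br_br [(0 : 'rV[C]_d) 0 p]mxE.
rewrite [X in _ + X + _]rot [X in _ + X]rot [X in _ + X]rot.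
rewrite -!big_split big1 // => i _ /=; rewrite -!big_split big1 // => j _ /=.
rewrite -!big_split big1 // => k _ /=.
rewrite [Y 0 j * Z 0 k * X 0 i]mulrC [Z 0 k * X 0 i]mulrC.
rewrite [X 0 i * Z 0 k * Y 0 j]mulrAC !mulrA -!mulrDr -!rmorphD.
rewrite -!big_split (strc_jacobi brP b_basis i j k p) rmorph0 mulr0 //.
Qed.

Lemma dotC X Y : dot X Y = dot Y X.
Proof. by apply: eq_bigr => i _; rewrite mulrC. Qed.

Lemma dot_invariant X Y Z : dot [X, Y] Z = dot X [Y, Z].
Proof.
rewrite /dot.
under eq_bigr => p _ do rewrite mxE mulr_suml.
rewrite exchange_big; apply: eq_bigr => i _ /=; rewrite mxE mulr_sumr.
under eq_bigr => p _ do rewrite mulr_suml.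
rewrite exchange_big; apply: eq_bigr => j _ /=; rewrite mulr_sumr.
apply: eq_bigr => p _; rewrite (strc_cyclic brP b_basis b_orth).
by rewrite !mulrA (mulrC (sc _)).
Qed.
End LieOverRing.

(** * The residue form on F((x)) x F[x]/(x^n) *)

Section Residue.
Variables (F : fieldType) (n : nat) (s : ps F) (alpha : ls F).
Hypothesis s_unit : ps_unit s.
Hypothesis alphaP : is_alpha n s alpha.

(** The form of L_n is this functional on F((x)) x F[x]/(x^n), applied to the
    contraction of two vectors over an orthonormal basis: its invariance is that
    of the Killing form. *)
Definition lp_res (u : lp n F) : F := ls_res (alpha * (u.1 - tp_ls u.2)).

Fact lp_res_additive : zmod_morphism lp_res.
Proof.
move=> u v; rewrite /lp_res.
have -> : tp_ls (u - v).2 = tp_ls u.2 - tp_ls v.2.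
  rewrite /tp_ls -raddfB; congr (ps_ls _); apply: psP => k.
  exact: etrans (tpDE _ _ _) (congr1 _ (tpNE _ _)).
have -> : (u - v).1 - (tp_ls u.2 - tp_ls v.2) =
    (u.1 - tp_ls u.2) - (v.1 - tp_ls v.2).
  by rewrite -[(u - v).1]/(u.1 - v.1) !opprD opprK addrACA.
by rewrite mulrBr.
Qed.
HB.instance Definition _ :=
  GRing.isZmodMorphism.Build (lp n F) F lp_res lp_res_additive.

Lemma lp_lift (u : lp n F) : u = (u.1, tp_trunc n (tp_ps u.2)).
Proof. by case: u => v p; rewrite tp_psK. Qed.

Lemma tp_trunc_Xn (f : ps F) : tp_trunc n (psX F ^+ n * f) = 0.
Proof. by apply: tp_ext => k kn; rewrite tp0E tp_truncE kn psXn_mulE leqNgt kn. Qed.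

Lemma ps_split m (f : ps F) :
  f = Ps (fun k => if (k < m)%N then f k else 0)
      + psX F ^+ m * Ps (fun k => f (m + k)%N).
Proof.
apply: psP => k; rewrite -[RHS]/(psf _ _ + psf (_ * _) _) psXn_mulE /=.
by case: ltnP => km; rewrite ?addr0 // add0r subnKC.
Qed.

(** As [alpha] lies in x^-n F[[x]], the residue does not see the choice of a
    power series that lifts a class modulo x^n. *)
Lemma lp_res_lift t (v : ls F) (f : ps F) : s * t = 1 ->
  lp_res (v, tp_trunc n f) = (ps_ls t * (v - ps_ls f)) (n%:Z - 1).
Proof.
move=> st.
have -> : lp_res (v, tp_trunc n f) =
    (ps_ls t * (v - tp_ls (tp_trunc n f))) (n%:Z - 1).
  rewrite /lp_res /ls_res.
  have -> : alpha = lsX F (- n%:Z) * ps_ls t.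
    rewrite -[LHS]mulr1 -(rmorph1 (@ps_ls F)) -st rmorphM /= mulrA.
    rewrite -{1}[alpha]mul1r -lsX0 -(addNr n%:Z) -lsXD -!mulrA.
    by rewrite [_ * (alpha * _)]mulrA [_ * _ * (_ * _)]mulrA alphaP mul1r.
  by rewrite -mulrA lsX_mulE; congr (lsf (_ * _) _); lia.
pose f1 := Ps (fun k => if (k < n)%N then f k else 0).
pose f2 := Ps (fun k => f (n + k)%N).
have -> : ps_ls f = ps_ls f1 + ps_ls (psX F ^+ n * f2).
  by rewrite -raddfD -ps_split.
rewrite opprD addrA [in RHS]mulrBr -rmorphM mulrCA [RHS]lsBE.
have -> : tp_ls (tp_trunc n f) = ps_ls f1 by [].
rewrite -[LHS]subr0; congr (_ - _); case: (n) => [|m] //.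
have -> : m.+1%:Z - 1 = m by lia.
by rewrite [RHS]psXn_mulE ltnn.
Qed.

Lemma lp_resZ c u : lp_res (lpC n c * u) = c * lp_res u.
Proof.
have [t st] := s_unit; rewrite (lp_lift u) -ps_lpC.
have -> : ps_lp n (psC c) * (u.1, tp_trunc n (tp_ps u.2)) =
    (ps_ls (psC c) * u.1, tp_trunc n (psC c * tp_ps u.2)).
  by rewrite rmorphM.
rewrite !(lp_res_lift _ _ st) rmorphM -mulrBr mulrCA.
have -> : ps_ls (psC c) = lsM c 0 by apply: lsP => -[] [|k].
by rewrite lsM_mulE subr0.
Qed.

Lemma lp_res_ps f : lp_res (ps_lp n f) = 0.
Proof. by have [t st] := s_unit; rewrite (lp_res_lift _ _ st) subrr mulr0. Qed.

Lemma lp_res_mul t f (u : lp n F) : s * t = 1 ->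
  lp_res (ps_lp n f * u) =
  (ps_ls f * (ps_ls t * (u.1 - ps_ls (tp_ps u.2)))) (n%:Z - 1).
Proof.
move=> st; rewrite {1}(lp_lift u).
have -> : ps_lp n f * (u.1, tp_trunc n (tp_ps u.2)) =
    (ps_ls f * u.1, tp_trunc n (f * tp_ps u.2)) by rewrite rmorphM.
by rewrite (lp_res_lift _ _ st) rmorphM -mulrBr mulrCA.
Qed.

Lemma ls_ps (w : ls F) (m : nat) : (forall k, w (m%:Z - 1 - k%:Z) = 0) ->
  w = ps_ls (psX F ^+ m * Ps (fun k => w (m%:Z + k%:Z))).
Proof.
move=> w0; apply: lsP => e; case: (boolP (e < m%:Z)) => em.
  have -> : e = m%:Z - 1 - (absz (m%:Z - 1 - e)%R)%:Z by lia.
  rewrite w0; set e' := _ - _; have : e' < m%:Z by rewrite /e'; lia.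
  case: e' => k // km; rewrite [RHS]psXn_mulE ifN //; lia.
have -> : e = m%:Z + (absz (e - m%:Z)%R)%:Z by lia.
by rewrite ps_lsM ps_lsXn lsX_mulE addrAC subrr add0r.
Qed.

(** Orthogonality to all powers of x forces the first component and a lift of
    the second one to differ by an element of x^n F[[x]]. *)
Lemma lp_res_perp u : (forall k, lp_res (ps_lp n (psX F ^+ k) * u) = 0) ->
  exists f, u = ps_lp n f.
Proof.
move=> u0; have [t st] := s_unit; pose w := ps_ls t * (u.1 - ps_ls (tp_ps u.2)).
have /ls_ps wE k : w (n%:Z - 1 - k%:Z) = 0.
  by rewrite -(u0 k) (lp_res_mul _ _ st) ps_lsXn lsX_mulE.
set w' := psX F ^+ n * _ in wE; exists (tp_ps u.2 + s * w').
rewrite raddfD {1}(lp_lift u); congr (_, _); last first.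
  by rewrite /w' mulrCA /= tp_trunc_Xn addr0.
by rewrite /= ps_lsM -wE /w mulrA -ps_lsM st rmorph1 mul1r addrC subrK.
Qed.

Lemma lp_res_bounded (u : lp n F) :
  exists N, forall f : ps F, (forall k, (k < N)%N -> f k = 0) ->
    lp_res (ps_lp n f * u) = 0.
Proof.
have [t st] := s_unit; pose w := ps_ls t * (u.1 - ps_ls (tp_ps u.2)).
have [M wM] := ls_bnd w; exists (n + M)%N => f f0.
rewrite (lp_res_mul _ _ st) -/w.
have -> : f = psX F ^+ (n + M) * Ps (fun k => f (n + M + k)%N).
  rewrite {1}(ps_split (n + M) f) -[RHS]add0r; congr (_ + _).
  by apply: psP => k /=; case: ltnP => // /f0.
rewrite ps_lsM ps_lsXn -mulrA lsX_mulE; set f' := ps_ls _.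
apply: (@ls_conv_small _ f' w 0 M) => //; first by case.
by lia.
Qed.

Lemma kernM k f : (ps_lp n f * kern F n k) =
  if (k < n)%N then (0, tp_trunc n (- (f * psX F ^+ (n - 1 - k))))
  else (ps_ls f * lsX F (n%:Z - 1 - k%:Z), 0).
Proof.
rewrite /kern /=; case: ifP => _.
  congr (_, _); first exact: mulr0.
  by rewrite tp_truncN tp_truncM -mulrN.
by congr (_, _); exact: mulr0.
Qed.

(** As [alpha] s = x^-n, the factor s cancels and the residue of
    f x^(-n) x^(n-1-k) is left; the minus sign of the form on the second
    component meets the minus sign in the coefficients with k < n. *)
Lemma lp_res_kern f k : lp_res (ps_lp n f * (ps_lp n s * kern F n k)) = f k.
Proof.
have [t st] := s_unit.
rewrite mulrA -rmorphM kernM; case: ltnP => kn.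
  rewrite (lp_res_lift _ _ st) add0r (raddfN (@ps_ls F)) opprK -ps_lsM.
  rewrite mulrA [f * s]mulrC !mulrA [t * s]mulrC st mul1r ps_lsM mulrC ps_lsXn.
  rewrite lsX_mulE; have -> : n%:Z - 1 - (n - 1 - k)%N%:Z = k by lia.
  by [].
have -> : 0 = tp_trunc n (0 : ps F) by rewrite raddf0.
rewrite (lp_res_lift _ _ st) (raddf0 (@ps_ls F)) subr0 mulrA -ps_lsM.
rewrite mulrA [t * f]mulrC -mulrA [t * s]mulrC st mulr1 mulrC lsX_mulE.
by have -> : n%:Z - 1 - (n%:Z - 1 - k%:Z) = k by lia.
Qed.

(** The residue of s x^(-n) x^(2n-2-k-l), with the sign of the component in
    which the k-th and the l-th coefficient of y^n / (x - y) both live. *)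
Definition kern_coef (k l : nat) : F :=
  let e := ps_ls s (k%:Z + l%:Z + 1 - n%:Z) in
  if (n <= k)%N && (n <= l)%N then e else
  if (k < n)%N && (l < n)%N then - e else 0.

Lemma lp_res_kern2 k l :
  lp_res (ps_lp n s * kern F n k * (ps_lp n s * kern F n l)) = kern_coef k l.
Proof.
have [t st] := s_unit.
have res0 : lp_res 0 = 0 by rewrite raddf0.
rewrite !kernM /kern_coef; case: (ltnP k n) => kn; case: (ltnP l n) => ln /=.
- rewrite -[lp_res _]/(lp_res (0 * 0, _ * _)) mul0r -tp_truncM mulrNN.
  rewrite (lp_res_lift _ _ st) add0r mulrN -ps_lsM -[LHS]/(- lsf _ _); congr (- _).
  rewrite mulrACA [t * _]mulrA [t * _]mulrA [t * s]mulrC st mul1r -exprD.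
  rewrite ps_lsM mulrC ps_lsXn lsX_mulE; congr (ps_ls_fun _ _); lia.
- by rewrite -[lp_res _]/(lp_res (0 * _, _ * 0)) mul0r mulr0.
- by rewrite -[lp_res _]/(lp_res (_ * 0, 0 * _)) mul0r mulr0.
have E : (0 : tp n F) * 0 = tp_trunc n (0 : ps F) by rewrite mulr0 raddf0.
rewrite -[lp_res _]/(lp_res (_ * _, _ * _)) E.
rewrite (lp_res_lift _ _ st) (raddf0 (@ps_ls F)) subr0 mulrACA lsXD !mulrA -ps_lsM.
rewrite [t * s]mulrC st rmorph1 mul1r mulrC lsX_mulE.
by congr (ps_ls_fun _ _); lia.
Qed.

Lemma kern_coef_rec k l :
  (if l is l'.+1 then kern_coef k l' else 0) -
  (if k is k'.+1 then kern_coef k' l else 0) =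
  (if k == n then s l else 0) - (if l == n then s k else 0).
Proof.
(* both sides involve s only at the exponent k + l - n *)
pose e : int := k%:Z + l%:Z - n%:Z; pose sg := ps_ls s : int -> F.
have sgN m : (m < 0)%R -> sg m = 0 by case: m.
have -> : (if k == n then s l else 0) = if k == n then sg e else 0.
  by case: eqP => // kn; have -> : e = l by rewrite /e; lia.
have -> : (if l == n then s k else 0) = if l == n then sg e else 0.
  by case: eqP => // ln; have -> : e = k by rewrite /e; lia.
have kE k' l' : (k' + l').+1 = (k + l)%N -> kern_coef k' l' =
  if (n <= k')%N && (n <= l')%N then sg e else
  if (k' < n)%N && (l' < n)%N then - sg e else 0.
  by move=> kl; rewrite /kern_coef; have -> : k'%:Z + l'%:Z + 1 - n%:Z = e by lia.
case: k l @e kE => [|k] [|l] e kE; rewrite ?kE; try by lia.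
- by rewrite subrr; case: ifP => _; rewrite subrr.
all: case: (boolP (e < 0)) => [/sgN ->|]; first by
  rewrite ?oppr0; do ?[case: ifP => _]; rewrite ?oppr0 ?addr0.
all: rewrite /e => e0; move: (sg _) => x; do 2 case: eqP => ?.
all: do ?[case: ifP => ?]; try (exfalso; lia).
all: by rewrite ?opprK ?subrr ?addNr ?subr0 ?sub0r ?opprK ?add0r.
Qed.

(** This is (s(x) y^n - s(y) x^n) / (x - y). Its coefficients are the pairings
    of the coefficients of s(x) y^n / (x - y) with one another, which is why
    skew-symmetry of a series amounts to isotropy. *)
Definition kern_quot : ps (ps F) := Ps (fun k => Ps (fun l => kern_coef k l)).

(** The quotient is unique because x - y is not a zero divisor. *)
Lemma kern_quotP (h : ps (ps F)) :
  (psC (psX F) - psX (ps F)) * h =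
     psC s * psX (ps F) ^+ n - ps_map (@psC F) s * psC (psX F ^+ n) <->
  h = kern_quot.
Proof.
have coefL (a : ps (ps F)) k l : ((psC (psX F) - psX (ps F)) * a) k l =
    (if l is l'.+1 then a k l' else 0) - (if k is k'.+1 then a k' l else 0).
  rewrite mulrBl !psBE psC_mulE !psX_mulE.
  by congr (_ - _); case: k.
have coefR k l : (psC s * psX (ps F) ^+ n
      - ps_map (@psC F) s * psC (psX F ^+ n)) k l =
    (if k == n then s l else 0) - (if l == n then s k else 0).
  rewrite !psBE [_ * psC _]mulrC !psC_mulE psXnE [psX F ^+ n * _]mulrC.
  rewrite [ps_map _ _ _]/= psC_mulE psXnE.
  by congr (_ - _); case: eqP => _; rewrite ?mulr1 ?mulr0.
have hP : (psC (psX F) - psX (ps F)) * kern_quot =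
     psC s * psX (ps F) ^+ n - ps_map (@psC F) s * psC (psX F ^+ n).
  apply: psP => k; apply: psP => l; rewrite coefL coefR.
  by rewrite -kern_coef_rec; case: k.
split=> [|-> //]; rewrite -hP => /eqP; rewrite -subr_eq0 -mulrBr => /eqP.
set D := h - _ => D0; suff: D = 0 by move/eqP; rewrite subr_eq0 => /eqP.
apply: psP => k; apply: psP => l.
have E k' l' := congr1 (fun a : ps (ps F) => a k' l') D0.
elim: k l => [|k IH] l.
  by have := E 0%N l.+1; rewrite coefL subr0.
have := E k.+1 l.+1; rewrite coefL [X in _ - X = _ -> _]IH subr0.
by [].
Qed.
End Residue.

(** * Alternation of tensors with two, three and four factors *)

Section Alternation.
Variables (F : fieldType) (d : nat).
Local Notation A := ('I_d * nat)%type.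

Section Arity.
Variable m : nat.
Implicit Types (T : ('I_m -> A) -> F) (u : 'I_m -> A).

Lemma perm_tensM (s t : 'S_m) T :
  perm_tens t (perm_tens s T) = perm_tens (t * s)%g T.
Proof.
apply/funext => u; congr (T _); apply/funext => j.
by rewrite invMg permM.
Qed.

Lemma Alt_perm (s : 'S_m) T u : Alt (perm_tens s T) u = (-1) ^+ s * Alt T u.
Proof.
rewrite /Alt mulr_sumr (reindex_inj (mulIg s^-1%g)); apply: eq_bigr => t _ /=.
rewrite perm_tensM mulgKV mulrA; congr (_ * _).
by rewrite odd_permM odd_permV signr_addb mulrC.
Qed.

Lemma Alt_tperm i j T u :
  i != j -> Alt (perm_tens (tperm i j) T) u = - Alt T u.
Proof. by move=> ij; rewrite Alt_perm odd_tperm ij expr1 mulN1r. Qed.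

Lemma AltD T T' u : Alt (fun v => T v + T' v) u = Alt T u + Alt T' u.
Proof. by rewrite -big_split; apply: eq_bigr => t _; rewrite /perm_tens mulrDr. Qed.

Lemma skew_tens_tperm T :
  (forall i j u, i != j -> perm_tens (tperm i j) T u = - T u) -> skew_tens T.
Proof.
move=> Tsw s; have [ts -> {s}] := prod_tpermP s.
elim: ts => [_ u|[i j] ts IH /= /andP[ij /IH{}IH] u].
  rewrite big_nil odd_perm1 mul1r; congr (T _); apply/funext => k.
  by rewrite invg1 perm1.
rewrite big_cons -perm_tensM odd_permM odd_tperm /= ij /=.
rewrite -[LHS]/(perm_tens _ T _) IH -[T _]/(perm_tens (tperm i j) T u) Tsw //.
by rewrite signrN mulNr mulrN.
Qed.

Lemma Alt_skew T u : skew_tens T -> Alt T u = (m`!)%:R * T u.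
Proof.
move=> Tskew; rewrite /Alt (eq_bigr (fun=> T u)) => [|s _].
  by rewrite sumr_const card_Sn mulr_natl.
by rewrite Tskew mulrA -signr_addb addbb mul1r.
Qed.
End Arity.

Definition tens2 (Phi : A -> A -> F) (u : 'I_2 -> A) :=
  Phi (u (inord 0)) (u (inord 1)).
Definition tens3 (Phi : A -> A -> A -> F) (u : 'I_3 -> A) :=
  Phi (u (inord 0)) (u (inord 1)) (u (inord 2)).
Definition tens4 (Phi : A -> A -> A -> A -> F) (u : 'I_4 -> A) :=
  Phi (u (inord 0)) (u (inord 1)) (u (inord 2)) (u (inord 3)).

Lemma inord_eq m i j : (i < m.+1)%N -> (j < m.+1)%N ->
  (inord i == inord j :> 'I_m.+1) = (i == j).
Proof. by move=> im jm; rewrite -val_eqE /= !inordK. Qed.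

(* evaluates a transposition of two concrete indices *)
Local Ltac swap_inord := apply/funext => u; rewrite /perm_tens /=;
  rewrite ?/tens2 ?/tens3 ?/tens4 tpermV !permE /= !inord_eq //=.

Lemma tens2_swap Phi :
  perm_tens (tperm (inord 0) (inord 1)) (tens2 Phi) = tens2 (fun x y => Phi y x).
Proof. by swap_inord. Qed.

Lemma tens3_swap01 Phi : perm_tens (tperm (inord 0) (inord 1)) (tens3 Phi) =
  tens3 (fun x y z => Phi y x z).
Proof. by swap_inord. Qed.

Lemma tens3_swap12 Phi : perm_tens (tperm (inord 1) (inord 2)) (tens3 Phi) =
  tens3 (fun x y z => Phi x z y).
Proof. by swap_inord. Qed.

Lemma tens3_swap02 Phi : perm_tens (tperm (inord 0) (inord 2)) (tens3 Phi) =
  tens3 (fun x y z => Phi z y x).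
Proof. by swap_inord. Qed.

Lemma tens4_swap01 Phi : perm_tens (tperm (inord 0) (inord 1)) (tens4 Phi) =
  tens4 (fun x y z w => Phi y x z w).
Proof. by swap_inord. Qed.

Lemma tens4_swap12 Phi : perm_tens (tperm (inord 1) (inord 2)) (tens4 Phi) =
  tens4 (fun x y z w => Phi x z y w).
Proof. by swap_inord. Qed.

Lemma tens4_swap02 Phi : perm_tens (tperm (inord 0) (inord 2)) (tens4 Phi) =
  tens4 (fun x y z w => Phi z y x w).
Proof. by swap_inord. Qed.

Lemma tens4_swap13 Phi : perm_tens (tperm (inord 1) (inord 3)) (tens4 Phi) =
  tens4 (fun x y z w => Phi x w z y).
Proof. by swap_inord. Qed.

Lemma tens2_skew Phi : (forall x y, Phi y x = - Phi x y) ->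
  skew_tens (tens2 Phi).
Proof.
move=> sk; apply: skew_tens_tperm => i j u.
have -> : i = inord i by rewrite inord_val.
have -> : j = inord j by rewrite inord_val.
case: i j => [[|[|//]] ?] [[|[|//]] ?] /=; rewrite ?eqxx //= => _.
  by rewrite tens2_swap /tens2 sk.
by rewrite tpermC tens2_swap /tens2 sk.
Qed.

Lemma tens3_skew Phi : (forall x y z, Phi y x z = - Phi x y z) ->
  (forall x y z, Phi x z y = - Phi x y z) -> skew_tens (tens3 Phi).
Proof.
move=> sk01 sk12; apply: skew_tens_tperm => i j u.
have sk02 x y z : Phi z y x = - Phi x y z by rewrite sk01 sk12 sk01 opprK.
have -> : i = inord i by rewrite inord_val.
have -> : j = inord j by rewrite inord_val.
case: i j => [[|[|[|//]]] ?] [[|[|[|//]]] ?] /=; rewrite ?eqxx //= => _.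
- by rewrite tens3_swap01 /tens3 sk01.
- by rewrite tens3_swap02 /tens3 sk02.
- by rewrite tpermC tens3_swap01 /tens3 sk01.
- by rewrite tens3_swap12 /tens3 sk12.
- by rewrite tpermC tens3_swap02 /tens3 sk02.
by rewrite tpermC tens3_swap12 /tens3 sk12.
Qed.

Hypothesis F_char0 : [pchar F] =i pred0.

Lemma natr_neq0 k : k.+1%:R != 0 :> F.
Proof. by rewrite ((pcharf0P F).1 F_char0). Qed.

(** The sum over cyclic rotations is skew, so that its alternation is six times
    itself; rotations being even, it is also three times that of the tensor. *)
Lemma Alt_cyclic Phi u :
  (forall x y z, Phi y x z = - Phi x y z) ->
  2%:R^-1 * Alt (tens3 Phi) u =
  tens3 (fun x y z => Phi x y z + Phi y z x + Phi z x y) u.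
Proof.
move=> sk; set R := fun _ _ _ => _.
have rot : Alt (tens3 (fun x y z => Phi y z x)) u = Alt (tens3 Phi) u.
  have n01 : inord 0 != inord 1 :> 'I_3 by rewrite inord_eq.
  have n12 : inord 1 != inord 2 :> 'I_3 by rewrite inord_eq.
  rewrite -[RHS]opprK -(Alt_tperm _ _ n12) -(Alt_tperm _ _ n01).
  by rewrite tens3_swap12 tens3_swap01.
have rot2 : Alt (tens3 (fun x y z => Phi z x y)) u = Alt (tens3 Phi) u.
  have n01 : inord 0 != inord 1 :> 'I_3 by rewrite inord_eq.
  have n12 : inord 1 != inord 2 :> 'I_3 by rewrite inord_eq.
  rewrite -[RHS]opprK -(Alt_tperm _ _ n01) -(Alt_tperm _ _ n12).
  by rewrite tens3_swap01 tens3_swap12.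
have skR : skew_tens (tens3 R).
  apply: tens3_skew => x y z; rewrite /R.
    by rewrite (sk x y) (sk z x) (sk y z) -!opprD addrAC.
  by rewrite (sk z x) (sk y z) (sk x y) -!opprD addrC addrA addrAC.
have := Alt_skew u skR; rewrite [tens3 R in LHS]/tens3 /R AltD AltD.
rewrite -!/(tens3 _) [X in _ + X + _]rot [X in _ + X]rot2.
rewrite -addrA -[LHS]/(Alt (tens3 Phi) u *+ 3) -[LHS]mulr_natl (_ : 3`! = 3 * 2)%N //.
rewrite natrM -mulrA => /(mulfI (natr_neq0 2)) ->.
by rewrite mulrA mulVf ?mul1r ?(natr_neq0 1).
Qed.

(** Both (02)(13) and the rotations of the first three factors are even, so that
    the alternation is unchanged when a tensor is replaced by its mean over
    these permutations. *)
Lemma Alt4_eq0 Phi u :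
  let Psi x y z w := Phi x y z w + Phi z w x y in
  (forall x y z w, Psi x y z w + Psi y z x w + Psi z x y w = 0) ->
  Alt (tens4 Phi) u = 0.
Proof.
move=> Psi Psi0.
have swap T : Alt (tens4 (fun x y z w => T z w x y)) u = Alt (tens4 T) u.
  have n02 : inord 0 != inord 2 :> 'I_4 by rewrite inord_eq.
  have n13 : inord 1 != inord 3 :> 'I_4 by rewrite inord_eq.
  rewrite -[RHS]opprK -(Alt_tperm _ _ n02) -(Alt_tperm _ _ n13).
  by rewrite tens4_swap02 tens4_swap13.
have n01 : inord 0 != inord 1 :> 'I_4 by rewrite inord_eq.
have n12 : inord 1 != inord 2 :> 'I_4 by rewrite inord_eq.
have rot T : Alt (tens4 (fun x y z w => T y z x w)) u = Alt (tens4 T) u.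
  rewrite -[RHS]opprK -(Alt_tperm _ _ n12) -(Alt_tperm _ _ n01).
  by rewrite tens4_swap12 tens4_swap01.
have PsiE : Alt (tens4 Psi) u = 2%:R * Alt (tens4 Phi) u.
  by rewrite [tens4 Psi]/tens4 AltD -!/(tens4 _) [X in _ + X]swap mulr_natl.
apply: (mulfI (natr_neq0 1)); rewrite -PsiE mulr0.
apply: (mulfI (natr_neq0 2)); rewrite mulr0 mulr_natl.
rewrite -[LHS]/(Alt _ u + (Alt _ u + Alt _ u)) addrA.
rewrite -{2}(rot Psi) -{2}(rot Psi) -{2}(rot (fun x y z w => Psi y z x w)).
rewrite -!AltD /Alt big1 // => t _; rewrite /perm_tens /tens4.
by rewrite Psi0 mulr0.
Qed.
End Alternation.

(** * Lie algebras split into two isotropic subspaces *)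

(** The quasi-Lie bialgebra axioms, in a Lie algebra V with an invariant form B
    that splits into two isotropic subspaces; [P] is the projection to one of
    them. Both subspaces being isotropic, B(X, P Y) + B(P X, Y) = B(X, Y): this
    reassembles the projected terms in pairs, and what remains in each of the
    three identities is a case of the Jacobi identity. *)
Section IsotropicSplitting.
Variables (V K : zmodType) (B : V -> V -> K) (br : V -> V -> V) (P : V -> V).
Hypothesis BC : forall x y, B x y = B y x.
Hypothesis BD : forall x y z, B x (y + z) = B x y + B x z.
Hypothesis br_skew : forall x y, br x y = - br y x.
Hypothesis br_jacobi :
  forall x y z, br x (br y z) + br y (br z x) + br z (br x y) = 0.
Hypothesis B_inv : forall x y z, B (br x y) z = B x (br y z).
Hypothesis B_split : forall x y, B x (P y) + B y (P x) = B x y.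

Let B0 x : B x 0 = 0.
Proof. by apply: (@addrI _ (B x 0)); rewrite -BD !addr0. Qed.

Let BN x y : B x (- y) = - B x y.
Proof. by apply/eqP; rewrite -addr_eq0 -BD addNr B0. Qed.

Let BNl x y : B (- x) y = - B x y.
Proof. by rewrite BC BN BC. Qed.

Let B_cyc x y z : B x (br y z) = B y (br z x).
Proof. by rewrite BC B_inv. Qed.

Let jacobiB x y z t :
  B (br x y) (br z t) + B (br y z) (br x t) + B (br z x) (br y t) = 0.
Proof.
have E u v w : B (br u v) (br w t) = - B t (br w (br u v)).
  by rewrite B_cyc B_cyc (br_skew (br u v)) BN.
by rewrite !E -!opprD -!BD -addrA addrC br_jacobi B0 oppr0.
Qed.

Lemma split_cocycle x x' f h : B (br x x') (br f h) =
  B x' (br (P (br f x)) h) + B x' (br f (P (br h x))) -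
  (B x (br (P (br f x')) h) + B x (br f (P (br h x')))).
Proof.
have E y y' : B y (br (P (br f y')) h) + B y (br f (P (br h y'))) =
    B (br h y) (P (br f y')) - B (br f y) (P (br h y')).
  rewrite B_cyc BC; congr (_ + _).
  by rewrite -B_inv (br_skew y) BNl.
rewrite !E opprB addrACA [X in X + _]addrC B_split -opprD B_split.
have /eqP := jacobiB f x x' h.
rewrite addrAC addr_eq0 => /eqP J; rewrite -[LHS]opprK -J opprD.
by rewrite (br_skew x' h) BN opprK (br_skew x' f) (br_skew x h) BN BNl opprK.
Qed.

Lemma split_cojacobi x f h k :
  B x (br (P (br f h)) k) + B x (br (P (br h k)) f) + B x (br (P (br k f)) h) =
  - (B (br (P (br f x)) h) k + B (br f (P (br h x))) k + B (br f h) (P (br k x))).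
Proof.
have E1 u v w : B x (br (P (br u v)) w) = B (br w x) (P (br u v)).
  by rewrite B_cyc BC.
have E2 : B (br (P (br f x)) h) k = B (br h k) (P (br f x)) by rewrite B_inv BC.
have E3 : B (br f (P (br h x))) k = B (br k f) (P (br h x)).
  by rewrite B_inv B_cyc BC.
apply/eqP; rewrite -addr_eq0 !E1 E2 E3; apply/eqP.
rewrite [X in _ + X]addrC [X in _ + X]addrA addrACA [X in X + _]addrACA !B_split.
by rewrite !(BC (br _ x)) jacobiB.
Qed.

Lemma split_pentagon x y z t :
  let Phi x y z t := - B (br (P (br x y)) z) t in
  let Psi x y z t := Phi x y z t + Phi z t x y in
  Psi x y z t + Psi y z x t + Psi z x y t = 0.
Proof.
move=> Phi Psi.
have E u v w s : Psi u v w s = - B (br u v) (br w s).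
  rewrite /Psi /Phi -opprD; congr (- _); rewrite !B_inv addrC.
  by rewrite !(BC (P _)) B_split.
by rewrite !E -!opprD jacobiB oppr0.
Qed.
End IsotropicSplitting.

(** * The invariant form on L_n *)

Section ManinPair.
Variables (F : fieldType) (g : vectType F) (br : g -> g -> g).
Variables (d : nat) (b : d.-tuple g).
Hypothesis brP : lie_bracket br.
Hypothesis b_basis : basis_of fullv b.
Hypothesis b_orth : forall i j : 'I_d, killing br b`_i b`_j = (i == j)%:R.
Variables (n : nat) (s : ps F) (alpha : ls F).
Hypothesis s_unit : ps_unit s.
Hypothesis alphaP : is_alpha n s alpha.

Local Notation L := 'rV[lp n F]_d.
Local Notation g1 := 'rV[ps F]_d.
Local Notation "[ X , Y ]" := (brL br b X Y) : ring_scope.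
Local Notation B := (@formL F g br d b n alpha).
Local Notation res := (lp_res alpha).
Implicit Types (X Y Z : L) (a : g1) (c : F).

Lemma formE X Y : B X Y = res (dot X Y).
Proof.
rewrite /dot raddf_sum; apply: eq_bigr => i _.
rewrite (bigD1 i) //= big1 ?addr0 => [|j /negbTE ji].
  by rewrite b_orth eqxx mul1r.
by rewrite b_orth eq_sym ji mul0r.
Qed.

Lemma formC X Y : B X Y = B Y X.
Proof. by rewrite !formE dotC. Qed.

Lemma formDl X X' Y : B (X + X') Y = B X Y + B X' Y.
Proof.
rewrite !formE -raddfD; congr (res _); rewrite /dot -big_split.
by apply: eq_bigr => i _; rewrite mxE mulrDl.
Qed.

Lemma formZl c X Y : B (lpC n c *: X) Y = c * B X Y.
Proof.
rewrite !formE -(lp_resZ s_unit alphaP); congr (res _); rewrite mulr_sumr.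
by apply: eq_bigr => i _; rewrite mxE mulrA.
Qed.

Lemma formDr X Y Y' : B X (Y + Y') = B X Y + B X Y'.
Proof. by rewrite formC formDl !(formC X). Qed.

Lemma formZr c X Y : B X (lpC n c *: Y) = c * B X Y.
Proof. by rewrite formC formZl (formC X). Qed.

Lemma form0l X : B 0 X = 0.
Proof. by apply: (@addrI _ (B 0 X)); rewrite -formDl !addr0. Qed.

Lemma form0r X : B X 0 = 0.
Proof. by rewrite formC form0l. Qed.

Lemma formNl X Y : B (- X) Y = - B X Y.
Proof. by apply/eqP; rewrite -addr_eq0 -formDl addNr form0l. Qed.

Lemma formNr X Y : B X (- Y) = - B X Y.
Proof. by rewrite formC formNl (formC X). Qed.

Lemma form_suml I (r : seq I) P (G : I -> L) Y :
  B (\sum_(i <- r | P i) G i) Y = \sum_(i <- r | P i) B (G i) Y.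
Proof.
by apply: (big_morph (fun X => B X Y)) => [X X'|]; rewrite ?formDl ?form0l.
Qed.

Lemma form_sumr I (r : seq I) P (G : I -> L) Y :
  B Y (\sum_(i <- r | P i) G i) = \sum_(i <- r | P i) B Y (G i).
Proof. by rewrite formC form_suml; apply: eq_bigr => i _; rewrite formC. Qed.

Lemma brL_skew X Y : [X, Y] = - [Y, X].
Proof. exact: lie_br_skew. Qed.

Lemma brLDl X X' Y : [X + X', Y] = [X, Y] + [X', Y].
Proof. exact: lie_brDl. Qed.

Lemma brLDr X Y Y' : [X, Y + Y'] = [X, Y] + [X, Y'].
Proof. exact: lie_brDr. Qed.

Lemma brLNl X Y : [- X, Y] = - [X, Y].
Proof. exact: lie_brNl. Qed.

Lemma brLZl (x : lp n F) X Y : [x *: X, Y] = x *: [X, Y].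
Proof. exact: lie_brZl. Qed.

Lemma brL0l X : [0, X] = 0.
Proof. by rewrite -(scale0r X) brLZl !scale0r. Qed.

Lemma brL0r X : [X, 0] = 0.
Proof. by rewrite brL_skew brL0l oppr0. Qed.

Lemma brL_jacobi X Y Z : [X, [Y, Z]] + [Y, [Z, X]] + [Z, [X, Y]] = 0.
Proof. exact: lie_br_jacobi. Qed.

Lemma form_invariant X Y Z : B [X, Y] Z = B X [Y, Z].
Proof. by rewrite !formE dot_invariant. Qed.

Lemma diagD a a' : diag n (a + a') = diag n a + diag n a'.
Proof. exact: (map_mxD (@ps_lp n F)). Qed.

Lemma diagN a : diag n (- a) = - diag n a.
Proof. exact: (map_mxN (@ps_lp n F)). Qed.

Lemma diag0 : diag n (0 : g1) = 0.
Proof. exact: (map_mx0 (@ps_lp n F)). Qed.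

Lemma diag_sum I (r : seq I) P (G : I -> g1) :
  diag n (\sum_(i <- r | P i) G i) = \sum_(i <- r | P i) diag n (G i).
Proof. by apply: (big_morph (@diag F d n)); [exact: diagD | exact: diag0]. Qed.

Lemma diagZ c a : diag n (psC c *: a) = lpC n c *: diag n a.
Proof. by apply/rowP => i; rewrite !mxE rmorphM /= ps_lpC. Qed.

Lemma diag_brx a a' : diag n (brx br b a a') = [diag n a, diag n a'].
Proof.
apply/rowP => p; rewrite !mxE rmorph_sum; apply: eq_bigr => i _.
rewrite rmorph_sum; apply: eq_bigr => j _.
by rewrite !mxE !rmorphM /= ps_lpC.
Qed.

Lemma form_diag a a' : B (diag n a) (diag n a') = 0.
Proof.
rewrite formE -(lp_res_ps s_unit alphaP (dot a a')); congr (res _).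
rewrite /dot rmorph_sum; apply: eq_bigr => i _.
by rewrite !mxE rmorphM.
Qed.

Lemma form_diag_row a X : B (diag n a) X = \sum_i res (ps_lp n (a 0 i) * X 0 i).
Proof. by rewrite formE raddf_sum; apply: eq_bigr => i _; rewrite mxE. Qed.

(** Testing against vectors with one entry reduces this to [lp_res_perp]. *)
Lemma diag_perp X : (forall a, B (diag n a) X = 0) -> exists a, X = diag n a.
Proof.
move=> X0; have Xi i : exists f, X 0 i = ps_lp n f.
  apply: (lp_res_perp s_unit alphaP) => k.
  rewrite -(X0 (\row_j (if j == i then psX F ^+ k else 0))).
  rewrite form_diag_row (bigD1 i) //= mxE eqxx big1 ?addr0 // => j /negbTE ji.
  by rewrite mxE ji rmorph0 mul0r raddf0.
have [a aP] := choice Xi; exists (\row_i a i).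
by apply/rowP => i; rewrite !mxE.
Qed.

Lemma form_bounded X : exists N, forall a,
  (forall i k, (k < N)%N -> a 0 i k = 0) -> B (diag n a) X = 0.
Proof.
have [N NP] := choice (fun i => lp_res_bounded s_unit alphaP (X 0 i)).
exists (\max_i N i) => a a0; rewrite form_diag_row big1 // => i _.
by apply: NP => k ki; apply: a0; rewrite (leq_trans ki) // leq_bigmax.
Qed.

(** * Contraction of the first factor of a tensor *)

(** Contracting the first factor of a tensor with X turns the bracket of v with
    this factor into the bracket of X with v: this is the invariance of the
    form, read over an arbitrary ring E of coefficients.  [V] is the image of
    [v] in E. *)
Lemma contract_bracket (E0 : zmodType) (E : comPzRingType)
    (Lam : lp n F -> E -> E0) (sc : F -> E) (V : 'I_d -> E) (v X : L)
    (T : 'I_d -> E) :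
  (forall y, zmod_morphism (Lam y)) ->
  (forall u y y', Lam (y + y') u = Lam y u + Lam y' u) ->
  (forall c y u, Lam y (sc c * u) = Lam (lpC n c * y) u) ->
  (forall i y u, Lam y (V i * u) = Lam (v 0 i * y) u) ->
  \sum_p Lam (X 0 p) (\sum_i \sum_j sc (strc br b i j p) * V i * T j) =
  \sum_j Lam ([X, v] 0 j) (T j).
Proof.
move=> LamB LamD Lamsc LamV.
have Lam0 u : Lam 0 u = 0.
  by apply: (@addrI _ (Lam 0 u)); rewrite -LamD !addr0.
have Lamsum I (r : seq I) (G : I -> E) y :
    Lam y (\sum_(i <- r) G i) = \sum_(i <- r) Lam y (G i).
  pose m := GRing.isZmodMorphism.Build E E0 (Lam y) (LamB y).
  pose f : {additive E -> E0} := HB.pack (Lam y) m.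
  exact: (raddf_sum f).
have Lamsuml I (r : seq I) (G : I -> lp n F) u :
    Lam (\sum_(i <- r) G i) u = \sum_(i <- r) Lam (G i) u.
  by apply: (big_morph (fun y => Lam y u)) => [y y'|].
transitivity (\sum_j \sum_p \sum_i
    Lam (lpC n (strc br b p i j) * X 0 p * v 0 i) (T j)).
  rewrite [RHS]exchange_big; apply: eq_bigr => p _.
  rewrite Lamsum [RHS]exchange_big; apply: eq_bigr => i _.
  rewrite Lamsum; apply: eq_bigr => j _.
  have -> : strc br b i j p = strc br b p i j.
    by rewrite -(strc_cyclic brP b_basis b_orth).
  by rewrite -mulrA Lamsc LamV [v 0 i * _]mulrC.
apply: eq_bigr => j _; rewrite mxE Lamsuml; apply: eq_bigr => p _.
by rewrite Lamsuml.
Qed.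

(** Contracting the first factor is linear over the ring of the remaining
    variables, so that brackets with another factor pass through it. *)
Lemma contract_scalar (E1 E0 : comPzRingType) (Lam : 'I_d -> {additive E1 -> E0})
    (sg : {rmorphism E0 -> E1}) (sc : F -> E0) (sc1 : F -> E1)
    (w : 'I_d -> E0) (w1 : 'I_d -> E1) (T : 'I_d -> 'I_d -> E1) q :
  (forall p x u, Lam p (sg x * u) = x * Lam p u) ->
  (forall c, sc1 c = sg (sc c)) -> (forall i, w1 i = sg (w i)) ->
  \sum_p Lam p (\sum_i \sum_j sc1 (strc br b i j q) * w1 i * T p j) =
  \sum_i \sum_j sc (strc br b i j q) * w i * \sum_p Lam p (T p j).
Proof.
move=> LamZ scE wE; under eq_bigr => p _ do rewrite raddf_sum.
rewrite exchange_big; apply: eq_bigr => i _.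
under eq_bigr => p _ do rewrite raddf_sum.
rewrite exchange_big; apply: eq_bigr => j _.
rewrite mulr_sumr; apply: eq_bigr => p _.
by rewrite scE wE -rmorphM LamZ.
Qed.

Definition res_ps (y : lp n F) (u : ps F) : F := res (ps_lp n u * y).

Fact res_ps_additive y : zmod_morphism (res_ps y).
Proof. by move=> u v; rewrite /res_ps raddfB mulrBl raddfB. Qed.
HB.instance Definition _ y :=
  GRing.isZmodMorphism.Build (ps F) F (res_ps y) (res_ps_additive y).

Lemma res_psD y y' u : res_ps (y + y') u = res_ps y u + res_ps y' u.
Proof. by rewrite /res_ps mulrDr raddfD. Qed.

Lemma res_psM y (h u : ps F) : res_ps y (h * u) = res_ps (ps_lp n h * y) u.
Proof. by rewrite /res_ps rmorphM -mulrA mulrCA. Qed.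

Lemma res_psZ y c u : res_ps y (psC c * u) = c * res_ps y u.
Proof. by rewrite /res_ps rmorphM /= ps_lpC -mulrA (lp_resZ s_unit alphaP). Qed.

Lemma res_psC y c u : res_ps y (psC c * u) = res_ps (lpC n c * y) u.
Proof. by rewrite res_psM ps_lpC. Qed.

Lemma res_ps_scalar y (x : ps F) (u : ps (ps F)) :
  ps_map (res_ps y) (ps_map (@psC F) x * u) = x * ps_map (res_ps y) u.
Proof.
apply: psP => k; rewrite -[LHS]/(res_ps y (psf (_ * _) k)) !psME (raddf_sum (res_ps y)).
by apply: eq_bigr => i _; exact: res_psZ.
Qed.

Lemma res_ps_scalar2 y (x : ps (ps F)) (u : ps (ps (ps F))) :
  ps_map (ps_map (res_ps y)) (ps_map (ps_map (@psC F)) x * u) =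
  x * ps_map (ps_map (res_ps y)) u.
Proof.
apply: psP => k; rewrite -[LHS]/(ps_map (res_ps y) (psf (_ * _) k)) !psME.
rewrite (raddf_sum (ps_map (res_ps y))).
by apply: eq_bigr => i _; exact: res_ps_scalar.
Qed.

Local Notation contract2 := (contract2 br b alpha).
Local Notation contract3 := (contract3 br b alpha).
Local Notation pair2 := (pair2 br b alpha).
Local Notation pair3 := (pair3 br b alpha).
Local Notation brx := (brx br b).

Lemma contract2E X T q :
  contract2 X T 0 q = \sum_p ps_map (res_ps (X 0 p)) (T p q).
Proof.
apply: psP => l; rewrite ps_sumE mxE /= form_diag_row.
by apply: eq_bigr => i _; rewrite mxE.
Qed.

Lemma contract3E X T q t :
  contract3 X T q t = \sum_p ps_map (ps_map (res_ps (X 0 p))) (T p q t).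
Proof.
apply: psP => m; apply: psP => l; rewrite !ps_sumE mxE /= form_diag_row.
by apply: eq_bigr => i _; rewrite mxE.
Qed.

Lemma contract2_adx2 a X T :
  contract2 X (adx2 br b a T) =
  contract2 [X, diag n a] T + brx a (contract2 X T).
Proof.
apply/rowP => q; rewrite mxDE !contract2E.
under eq_bigr => p _ do rewrite mxE raddfD.
rewrite big_split; congr (_ + _).
  apply: (@contract_bracket _ _ (fun y => ps_map (res_ps y)) (@psC2 F)
    (map_mx (@psC _) a 0) (diag n a) X (T^~ q)).
  - by move=> y u v; rewrite raddfB.
  - by move=> u y y'; apply: psP => k; rewrite !ps_mapE res_psD.
  - by move=> c y u; apply: psP => k; rewrite !ps_mapE psC_mulE res_psC.
  by move=> i y u; apply: psP => k; rewrite !ps_mapE mxE psC_mulE mxE res_psM.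
rewrite mxE; under [RHS]eq_bigr => i _ do under eq_bigr => j _ do rewrite contract2E.
apply: (@contract_scalar _ _ (fun p => ps_map (res_ps (X 0 p)))
  (ps_map (@psC F)) (@psC F) (@psC2 F) (a 0)) => [p x u|c|i].
- exact: res_ps_scalar.
- by rewrite /= ps_map_psC.
by rewrite mxE.
Qed.

Lemma contract3_adx3 a X T :
  contract3 X (adx3 br b a T) =
  contract3 [X, diag n a] T + adx2 br b a (contract3 X T).
Proof.
apply/matrixP => q t; rewrite mxDE !contract3E.
under eq_bigr => p _ do rewrite /adx3 /act3 !(raddfD (ps_map (ps_map _))).
rewrite !big_split /= -addrA; congr (_ + _).
  apply: (@contract_bracket _ _ (fun y => ps_map (ps_map (res_ps y))) (@psC3 F)
    (map_mx (fun f => psC (psC f)) a 0) (diag n a) X (fun j => T j q t)).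
  - by move=> y u v; rewrite raddfB.
  - move=> u y y'; apply: psP => m; apply: psP => k.
    by rewrite !ps_mapE res_psD.
  - move=> c y u; apply: psP => m; apply: psP => k.
    by rewrite !ps_mapE !psC_mulE res_psC.
  move=> i y u; apply: psP => m; apply: psP => k.
  by rewrite !ps_mapE mxE !psC_mulE mxE res_psM.
rewrite mxE; congr (_ + _).
  under [RHS]eq_bigr => i _ do under eq_bigr => j _ do rewrite contract3E.
  apply: (@contract_scalar _ _ (fun p => ps_map (ps_map (res_ps (X 0 p))))
    (ps_map (ps_map (@psC F))) (@psC2 F) (@psC3 F) (map_mx (@psC _) a 0)
    _ (fun p j => T p j t)).
  - by move=> p x u; apply: res_ps_scalar2.
  - by move=> c; rewrite /psC3 /psC2 /= ps_map_psC /= ps_map_psC.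
  - by move=> i; rewrite !mxE /= ps_map_psC.
under [RHS]eq_bigr => i _ do under eq_bigr => j _ do rewrite contract3E.
apply: (@contract_scalar _ _ (fun p => ps_map (ps_map (res_ps (X 0 p))))
  (ps_map (ps_map (@psC F))) (@psC2 F) (@psC3 F) (map_mx (ps_map (@psC F)) a 0)
  _ (fun p j => T p q j)).
- by move=> p x u; apply: res_ps_scalar2.
- by move=> c; rewrite /psC3 /psC2 /= ps_map_psC /= ps_map_psC.
move=> i; rewrite !mxE; apply: psP => m.
exact: esym (ps_map_psC (@psC F) _).
Qed.

(** * Complements of the diagonal with a dual family *)

(** The coefficients of [r] are dual to the b_j x^k and pairwise orthogonal, as
    for a skew-symmetric series of type (n, s). *)
Variable r : 'M[ps (lp n F)]_d.
Definition fam k j : L := \row_i r i j k.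
Hypothesis fam_dual : forall a k j, B (diag n a) (fam k j) = a 0 j k.
Hypothesis fam_iso : forall k i l j, B (fam k i) (fam l j) = 0.

Local Notation W := (span_series r).
Local Notation g2 := 'M[ps (ps F)]_d.
Local Notation g3 := ('I_d -> 'I_d -> 'I_d -> ps (ps (ps F))).
Implicit Types (T : g2).

Definition projD X : g1 := \row_j Ps (fun k => B X (fam k j)).
Definition projW X : L := X - diag n (projD X).

Lemma projDE X j k : projD X 0 j k = B X (fam k j).
Proof. by rewrite mxE. Qed.

Lemma proj_split X : X = diag n (projD X) + projW X.
Proof. by rewrite addrC subrK. Qed.

Lemma span_fam k j : W (fam k j).
Proof.
exists k.+1, (fun l i => ((l == k) && (i == j))%:R).
rewrite big_ord_recr /= big1 ?add0r => [|l _]; last first.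
  by rewrite big1 // => i _; rewrite (ltn_eqF (ltn_ord l)) rmorph0 scale0r.
rewrite (bigD1 j) //= big1 ?addr0 => [|i /negbTE ij].
  by rewrite !eqxx rmorph1 scale1r.
by rewrite ij andbF rmorph0 scale0r.
Qed.

Lemma span_ind_fam (P : L -> Prop) :
  P 0 -> (forall X Y, P X -> P Y -> P (X + Y)) ->
  (forall c X, P X -> P (lpC n c *: X)) -> (forall k j, P (fam k j)) ->
  forall X, W X -> P X.
Proof.
move=> P0 PD PZ Pf X [N [c ->]].
by elim/big_ind: _ => // k _; elim/big_ind: _ => // j _; apply/PZ/Pf.
Qed.

Lemma span_iso X Y : W X -> W Y -> B X Y = 0.
Proof.
move=> WX WY; elim/span_ind_fam: X / WX => [|X X' X0 X'0|c X X0|k i].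
- exact: form0l.
- by rewrite formDl X0 X'0 addr0.
- by rewrite formZl X0 mulr0.
elim/span_ind_fam: Y / WY => [|X X' X0 X'0|c X X0|l j].
- exact: form0r.
- by rewrite formDr X0 X'0 addr0.
- by rewrite formZr X0 mulr0.
exact: fam_iso.
Qed.

Definition mono k (j : 'I_d) : g1 :=
  \row_i (if i == j then psX F ^+ k else 0).

(** Finitely many coefficients of [X] with respect to the dual basis are
    nonzero, since a Laurent series is bounded below; what they miss is
    orthogonal to the diagonal, hence on it. *)
Lemma projW_span X : W (projW X).
Proof.
have [N XN] := form_bounded X.
pose c k j := B (diag n (mono k j)) X.
pose w := \sum_(k < N) \sum_j lpC n (c k j) *: fam k j.
have Ww : W w by exists N, c.
have wE a : B (diag n a) w = \sum_(k < N) \sum_j c k j * a 0 j k.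
  rewrite form_sumr; apply: eq_bigr => k _; rewrite form_sumr.
  by apply: eq_bigr => j _; rewrite formZr fam_dual.
have [a Xwa] : exists a, X - w = diag n a.
  apply: diag_perp => a.
  pose a' := \row_i Ps (fun k => if (k < N)%N then 0 else a 0 i k) : g1.
  have aE : a = \sum_(k < N) \sum_j psC (a 0 j k) *: mono k j + a'.
    apply/rowP => i; apply: psP => l; rewrite mxDE summxE.
    rewrite -[RHS]/(psf _ l + psf _ l) ps_sumE.
    rewrite (eq_bigr (fun k : 'I_N => a 0 i k * (l == k)%:R)) => [|k _].
      rewrite mxE /=; case: ltnP => lN; last first.
        by rewrite big1 ?add0r // => k _; rewrite gtn_eqF ?mulr0 // (leq_trans _ lN).
      rewrite (bigD1 (Ordinal lN)) //= eqxx mulr1 big1 ?addr0 // => k kl.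
      by rewrite -[l]/(val (Ordinal lN)) val_eqE eq_sym (negbTE kl) mulr0.
    rewrite summxE ps_sumE (bigD1 i) //= big1 ?addr0 => [|j /negbTE ji].
      by rewrite !mxE eqxx psC_mulE psXnE.
    by rewrite !mxE eq_sym ji mulr0.
  rewrite formDr formNr wE; apply/eqP; rewrite subr_eq0; apply/eqP.
  rewrite {1}aE diagD formDl [X in _ + X]XN ?addr0 => [|i k kN]; last first.
    by rewrite mxE /= kN.
  rewrite diag_sum form_suml; apply: eq_bigr => k _.
  rewrite diag_sum form_suml; apply: eq_bigr => j _.
  by rewrite diagZ formZl mulrC.
suff -> : projW X = w by [].
rewrite /projW; have -> : projD X = a.
  apply/rowP => j; apply: psP => k; rewrite mxE /= -fam_dual -Xwa.
  by rewrite formDl formNl (span_iso Ww (span_fam k j)) subr0.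
by rewrite -Xwa subKr.
Qed.

Lemma projD_span X : W X -> projD X = 0.
Proof.
move=> WX; apply/rowP => j; apply: psP => k; rewrite !mxE /=.
exact: span_iso WX (span_fam k j).
Qed.

Lemma projW_id X : W X -> projW X = X.
Proof. by move=> /projD_span X0; rewrite /projW X0 diag0 subr0. Qed.

Lemma projD_diag a : projD (diag n a) = a.
Proof. by apply/rowP => j; apply: psP => k; rewrite mxE /= fam_dual. Qed.

Lemma projDN X : projD (- X) = - projD X.
Proof. by apply/rowP => j; apply: psP => k; rewrite !mxE /= formNl. Qed.

Lemma projWN X : projW (- X) = - projW X.
Proof. by rewrite /projW projDN diagN opprD. Qed.

(** Both the diagonal and [W] are isotropic: only the mixed terms of B(X, Y)
    survive. *)
Lemma form_split X Y : B X (projW Y) + B Y (projW X) = B X Y.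
Proof.
move: (projW_span X) (projW_span Y) (proj_split X) (proj_split Y).
move: (projW X) (projW Y) (projD X) (projD Y) => x y u v Wx Wy -> ->.
rewrite !(formDl, formDr) form_diag (span_iso Wx Wy) (span_iso Wy Wx).
by rewrite !(add0r, addr0) (formC x) addrC.
Qed.

Lemma span_lagrangian : lagrangian br b alpha W.
Proof.
move=> X; split=> [WX Y|X0]; first exact: span_iso.
suff -> : X = projW X by apply: projW_span.
rewrite /projW; have -> : projD X = 0; last by rewrite diag0 subr0.
by apply/rowP => j; apply: psP => k; rewrite !mxE /= X0 //; apply: span_fam.
Qed.

Lemma span_complementary : complementary W.
Proof.
split=> [X|a Wa].
  by exists (projD X), (projW X); split; [apply: projW_span | apply: proj_split].
by rewrite -(projD_diag a) projD_span // diag0.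
Qed.

Lemma pair2_fam T k p l q : pair2 T (fam k p) (fam l q) = T p q l k.
Proof. by rewrite /pair2 /Defs.pair2 fam_dual mxE /= fam_dual mxE. Qed.

Lemma pair3_fam (T : g3) k p l q m t :
  pair3 T (fam k p) (fam l q) (fam m t) = T p q t m l k.
Proof. by rewrite /pair3 /Defs.pair3 pair2_fam mxE /= fam_dual mxE. Qed.

(** * The structure given by a Lagrangian complement *)

Lemma form_diag_eq a a' X : a = a' -> B (diag n a) X = B (diag n a') X.
Proof. by move->. Qed.

Lemma pair2E T X Y : pair2 T X Y = B (diag n (contract2 X T)) Y.
Proof. by []. Qed.

Lemma pair3E (T : g3) X Y Z : pair3 T X Y Z = pair2 (contract3 X T) Y Z.
Proof. by []. Qed.

Lemma g2_eq T T' : (forall X Y, W X -> W Y -> pair2 T X Y = pair2 T' X Y) ->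
  T = T'.
Proof.
move=> TT'; apply/matrixP => p q; apply: psP => l; apply: psP => k.
by rewrite -(pair2_fam T) TT' ?pair2_fam //; apply: span_fam.
Qed.

Lemma pair2Dl T X X' Y : pair2 T (X + X') Y = pair2 T X Y + pair2 T X' Y.
Proof.
rewrite -formDl -diagD; apply: form_diag_eq.
by apply/rowP => j; apply: psP => l; rewrite !mxE /= formDr.
Qed.

Lemma pair2Dr T X Y Y' : pair2 T X (Y + Y') = pair2 T X Y + pair2 T X Y'.
Proof. exact: formDr. Qed.

Lemma pair2Zl T c X Y : pair2 T (lpC n c *: X) Y = c * pair2 T X Y.
Proof.
rewrite -formZl -diagZ; apply: form_diag_eq.
by apply/rowP => j; apply: psP => l; rewrite !mxE psC_mulE /= formZr.
Qed.

Lemma pair2Zr T c X Y : pair2 T X (lpC n c *: Y) = c * pair2 T X Y.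
Proof. exact: formZr. Qed.

Lemma pair2_diagl T u Y : pair2 T (diag n u) Y = 0.
Proof.
rewrite -(form0l Y) -[in RHS]diag0; apply: form_diag_eq.
by apply/rowP => j; apply: psP => l; rewrite !mxE /= form_diag.
Qed.

Lemma pair2_0l T Y : pair2 T 0 Y = 0.
Proof. by rewrite -[X in pair2 _ X]diag0 pair2_diagl. Qed.

Lemma pair2_projl T X Y : pair2 T X Y = pair2 T (projW X) Y.
Proof. by rewrite {1}(proj_split X) pair2Dl pair2_diagl add0r. Qed.

Lemma pair2_projr T X Y : pair2 T X Y = pair2 T X (projW Y).
Proof. by rewrite {1}(proj_split Y) pair2Dr [X in X + _]form_diag add0r. Qed.

Lemma pair2BT T T' X Y : pair2 (T - T') X Y = pair2 T X Y - pair2 T' X Y.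
Proof.
rewrite -formNl -formDl -diagN -diagD; apply: form_diag_eq.
apply/rowP => j; apply: psP => l; rewrite !mxE /=.
rewrite -formNl -formDl -diagN -diagD; apply: form_diag_eq.
by apply/rowP => i; apply: psP => k; rewrite !mxE.
Qed.

Lemma pair2DT T T' X Y : pair2 (T + T') X Y = pair2 T X Y + pair2 T' X Y.
Proof.
rewrite -formDl -diagD; apply: form_diag_eq.
apply/rowP => j; apply: psP => l; rewrite !mxE /=.
rewrite -formDl -diagD; apply: form_diag_eq.
by apply/rowP => i; apply: psP => k; rewrite !mxE.
Qed.

Lemma pair3Dl (T : g3) X X' Y Z :
  pair3 T (X + X') Y Z = pair3 T X Y Z + pair3 T X' Y Z.
Proof.
rewrite -pair2DT; congr (pair2 _ Y Z).
apply/matrixP => j k; rewrite mxDE; apply: psP => m; apply: psP => l.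
by rewrite !mxE /= formDr.
Qed.

Lemma contract3_diag (T : g3) u : contract3 (diag n u) T = 0.
Proof.
apply/matrixP => j k; apply: psP => m; apply: psP => l.
by rewrite !mxE /= form_diag.
Qed.

Lemma pair2_0 X Y : pair2 0 X Y = 0.
Proof. by rewrite -[0](subrr 0) pair2BT subrr. Qed.

Lemma pair3Zl (T : g3) c X Y Z :
  pair3 T (lpC n c *: X) Y Z = c * pair3 T X Y Z.
Proof.
rewrite /pair3 /Defs.pair3 -pair2Zl /pair2 /Defs.pair2; apply: form_diag_eq.
apply/rowP => j; apply: psP => l; rewrite !mxE /= formZr -formZl -diagZ.
apply: form_diag_eq; apply/rowP => i; apply: psP => k.
by rewrite !mxE psC_mulE /= formZr.
Qed.

Lemma pair3_proj (T : g3) X Y Z :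
  pair3 T X Y Z = pair3 T (projW X) (projW Y) (projW Z).
Proof.
rewrite {1}(proj_split X) pair3Dl {1}/pair3 /Defs.pair3 contract3_diag pair2_0.
by rewrite add0r -pair2_projr -pair2_projl.
Qed.

(** The structure dual to the bracket of the Lagrangian complement. As the form
    vanishes on the diagonal and on the complement, both projections of the
    bracket are seen by pairing the full bracket. *)
Definition str_delta a : g2 :=
  \matrix_(p, q) Ps (fun l => Ps (fun k => B (diag n a) [fam k p, fam l q])).
Definition str_phi : g3 := fun p q t =>
  Ps (fun m => Ps (fun l => Ps (fun k => - B [fam k p, fam l q] (fam m t)))).

Lemma str_deltaE a p q l k :
  str_delta a p q l k = B (diag n a) [fam k p, fam l q].
Proof. by rewrite mxE. Qed.

Lemma str_phiE p q t m l k :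
  str_phi p q t m l k = - B [fam k p, fam l q] (fam m t).
Proof. by []. Qed.

Lemma pair2_delta a X Y :
  pair2 (str_delta a) X Y = B (diag n a) [projW X, projW Y].
Proof.
rewrite pair2_projl pair2_projr.
move: (projW_span X) (projW_span Y); move: (projW X) (projW Y) => {}X {}Y WX WY.
elim/span_ind_fam: X / WX => [|X X' X0 X'0|c X X0|k p].
- by rewrite pair2_0l brL0l form0r.
- by rewrite pair2Dl brLDl formDr X0 X'0.
- by rewrite pair2Zl brLZl formZr X0.
elim/span_ind_fam: Y / WY => [|X X' X0 X'0|c X X0|l q].
- by rewrite brL0r [LHS]form0r form0r.
- by rewrite pair2Dr brLDr formDr X0 X'0.
- by rewrite pair2Zr brL_skew brLZl -scalerN -brL_skew formZr X0.
by rewrite pair2_fam mxE.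
Qed.

Lemma pair3_phi X Y Z :
  pair3 str_phi X Y Z = - B [projW X, projW Y] (projW Z).
Proof.
rewrite pair3_proj; move: (projW_span X) (projW_span Y) (projW_span Z).
move: (projW X) (projW Y) (projW Z) => {}X {}Y {}Z WX WY WZ.
elim/span_ind_fam: X / WX => [|X X' X0 X'0|c X X0|k p].
- rewrite brL0l form0l oppr0 -[X in pair3 _ X]diag0 /pair3 /Defs.pair3.
  by rewrite contract3_diag pair2_0.
- by rewrite pair3Dl brLDl formDl opprD X0 X'0.
- by rewrite pair3Zl brLZl formZl X0 mulrN.
elim/span_ind_fam: Y / WY => [|X X' X0 X'0|c X X0|l q].
- by rewrite brL0r form0l oppr0 [LHS]pair2_0l.
- by rewrite [LHS]pair2Dl brLDr formDl opprD -X0 -X'0.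
- by rewrite [LHS]pair2Zl brL_skew brLZl -scalerN -brL_skew formZl -mulrN -X0.
elim/span_ind_fam: Z / WZ => [|X X' X0 X'0|c X X0|m t].
- by rewrite form0r oppr0 [LHS]form0r.
- by rewrite [LHS]pair2Dr formDr opprD -X0 -X'0.
- by rewrite [LHS]pair2Zr formZr -mulrN -X0.
by rewrite pair3_fam.
Qed.

Lemma str_structure : structure_of br b alpha W str_delta str_phi.
Proof.
move=> X Y u v WX WY Wv XY; split=> [a|Z WZ].
  by rewrite -/(pair2 _ _ _) pair2_delta !projW_id // XY formDr form_diag add0r.
rewrite -/(pair3 _ _ _ _) pair3_phi !projW_id // XY formDl (span_iso Wv WZ).
by rewrite addr0 formC.
Qed.

(** Pairing with the dual family reads off the coefficients of a tensor. *)
Lemma structure_unique delta phi : structure_of br b alpha W delta phi ->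
  delta = str_delta /\ phi = str_phi.
Proof.
move=> st; have stf k p l q := st (fam k p) (fam l q) _ _ (span_fam k p)
  (span_fam l q) (projW_span [fam k p, fam l q]) (proj_split _).
split.
  apply/funext => a; apply/matrixP => p q; apply: psP => l; apply: psP => k.
  have [dE _] := stf k p l q; rewrite -pair2_fam -/(pair2 _ _ _) dE mxE /=.
  by rewrite [in RHS](proj_split [_, _]) formDr form_diag add0r.
apply/funext => p; apply/funext => q; apply/funext => t.
apply: psP => m; apply: psP => l; apply: psP => k.
have [_ /(_ _ (span_fam m t)) pE] := stf k p l q.
rewrite -pair3_fam [LHS]pE /= [in RHS](proj_split [_, _]) formDl.
by rewrite (span_iso (projW_span _) (span_fam m t)) addr0 formC.
Qed.

(** * The quasi-Lie bialgebra axioms *)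

Hypothesis F_char0 : [pchar F] =i pred0.
Local Notation fam' x := (fam x.2 x.1).

Lemma str_delta_linear c a a' :
  str_delta (psC c *: a + a') = psC2 c *: str_delta a + str_delta a'.
Proof.
apply/matrixP => p q; apply: psP => l; apply: psP => k.
rewrite mxDE -[RHS]/(psf (psf _ l) k + psf (psf _ l) k).
by rewrite mxZE !psC_mulE !str_deltaE diagD diagZ formDl formZl.
Qed.

Lemma str_delta_continuous : adic_continuous str_delta.
Proof.
move=> M.
have bnd (x : 'I_d * nat * ('I_d * nat)) :=
  form_bounded [fam' x.1, fam' x.2].
have [N NP] := choice bnd.
exists (\max_(i < d) \max_(j < d) \max_(k < M) \max_(l < M)
  N ((i, val k), (j, val l))) => a a0 i j k l klM.
have kM : (k < M)%N by rewrite (leq_ltn_trans _ klM) // leq_addr.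
have lM : (l < M)%N by rewrite (leq_ltn_trans _ klM) // leq_addl.
rewrite str_deltaE (NP ((i, k), (j, l))) // => i' k' k'N; apply: a0.
apply: (leq_trans k'N).
apply: (leq_trans _ (leq_bigmax i)); apply: (leq_trans _ (leq_bigmax j)).
apply: (leq_trans _ (leq_bigmax (Ordinal kM))).
exact: (leq_trans _ (leq_bigmax (Ordinal lM))).
Qed.

Lemma str_delta_skew a : skew_tens (coef2 (str_delta a)).
Proof.
have -> : coef2 (str_delta a) =
    tens2 (fun x y => B (diag n a) [fam' x, fam' y]).
  by apply/funext => u; rewrite /coef2 str_deltaE.
by apply: tens2_skew => x y; rewrite brL_skew formNr.
Qed.

Lemma str_phi_skew : skew_tens (coef3 str_phi).
Proof.
have -> : coef3 str_phi =
    tens3 (fun x y z => - B [fam' x, fam' y] (fam' z)) by [].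
apply: tens3_skew => x y z; move: (fam' x) (fam' y) (fam' z) => X Y Z.
  by rewrite brL_skew formNl.
by rewrite !form_invariant (brL_skew Z) formNr.
Qed.

Lemma pair2_adx2 a T X Y : pair2 (adx2 br b a T) X Y =
  pair2 T [X, diag n a] Y + pair2 T X [Y, diag n a].
Proof.
rewrite !pair2E contract2_adx2 diagD formDl; congr (_ + _).
rewrite diag_brx (brL_skew (diag n a)) formNl form_invariant.
by rewrite (brL_skew (diag n a)) formNr opprK.
Qed.

Lemma pair3_adx3 a (T : g3) X Y Z : pair3 (adx3 br b a T) X Y Z =
  pair3 T [X, diag n a] Y Z + pair3 T X [Y, diag n a] Z
  + pair3 T X Y [Z, diag n a].
Proof. by rewrite !pair3E contract3_adx3 pair2DT pair2_adx2 addrA. Qed.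

Lemma str_cocycle a a' : str_delta (brx a a') =
  adx2 br b a (str_delta a') - adx2 br b a' (str_delta a).
Proof.
apply: g2_eq => f h Wf Wh; rewrite pair2BT.
apply: etrans (pair2_delta _ _ _) _; rewrite diag_brx !projW_id //.
apply: etrans (split_cocycle formC formDr brL_skew brL_jacobi form_invariant
  form_split (diag n a) (diag n a') f h) _.
by congr (_ - _); rewrite pair2_adx2 !pair2_delta !(projW_id Wf) !(projW_id Wh).
Qed.

Lemma delta1_fam T p q j m l k :
  delta1 str_delta T p q j m l k = pair2 T [fam k p, fam l q] (fam m j).
Proof.
rewrite -[LHS]/(psf (psf (str_delta _ p q) l) k) str_deltaE pair2E fam_dual.
by rewrite mxE.
Qed.

Lemma delta11_fam (T : g3) p q i j m' m l k :
  delta11 str_delta T p q i j m' m l k =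
  pair3 T [fam k p, fam l q] (fam m i) (fam m' j).
Proof.
rewrite -[LHS]/(psf (psf (str_delta _ p q) l) k) str_deltaE pair3E pair2_fam.
by rewrite mxE.
Qed.

Lemma str_cojacobi a u :
  2%:R^-1 * Alt (coef3 (delta1 str_delta (str_delta a))) u =
  coef3 (adx3 br b a str_phi) u.
Proof.
have -> : coef3 (delta1 str_delta (str_delta a)) =
    tens3 (fun x y z => B (diag n a) [projW [fam' x, fam' y], fam' z]).
  apply/funext => v; rewrite /coef3 delta1_fam pair2_delta.
  by rewrite (projW_id (span_fam _ _)).
have sk x y z : B (diag n a) [projW [fam' y, fam' x], fam' z] =
    - B (diag n a) [projW [fam' x, fam' y], fam' z].
  move: (fam' x) (fam' y) (fam' z) => X Y Z; rewrite -formNr -brLNl.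
  by rewrite (brL_skew Y) projWN.
rewrite (Alt_cyclic F_char0 u sk) /tens3 /coef3.
rewrite -pair3_fam pair3_adx3 !pair3_phi.
have Pf x := projW_id (span_fam x.2 x.1).
rewrite !(Pf (u _)).
move: (fam' (u (inord 0))) (fam' (u (inord 1))) (fam' (u (inord 2))) => X Y Z.
apply: etrans (split_cojacobi formC formDr brL_skew brL_jacobi form_invariant
  form_split (diag n a) X Y Z) _.
by rewrite !opprD.
Qed.

Lemma str_pentagon u : Alt (coef4 (delta11 str_delta str_phi)) u = 0.
Proof.
have -> : coef4 (delta11 str_delta str_phi) = tens4 (fun x y z t =>
    - B [projW [fam' x, fam' y], fam' z] (fam' t)).
  apply/funext => v; rewrite /coef4 delta11_fam pair3_phi.
  by rewrite !(projW_id (span_fam _ _)).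
apply: (Alt4_eq0 F_char0) => x y z t.
exact: (split_pentagon formC formDr brL_skew brL_jacobi form_invariant
  form_split (fam' x) (fam' y) (fam' z) (fam' t)).
Qed.

Lemma str_tqlb : topological_quasi_lie_bialgebra br b str_delta str_phi.
Proof.
split; [exact: str_delta_linear | exact: str_delta_continuous
 | exact: str_delta_skew | exact: str_phi_skew | exact: str_cocycle
 | exact: str_cojacobi | exact: str_pentagon].
Qed.

(** * The bracket of the series with the diagonal *)

Local Notation A1 := (lp n F).
Local Notation A2 := (lp n A1).

Lemma spanD X Y : W X -> W Y -> W (X + Y).
Proof.
move=> WX WY; apply/span_lagrangian => Z WZ.
by rewrite formDl !(span_iso _ WZ) ?addr0.
Qed.

Lemma spanZ c X : W X -> W (lpC n c *: X).
Proof.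
move=> WX; apply/span_lagrangian => Z WZ.
by rewrite formZl (span_iso WX WZ) mulr0.
Qed.

Lemma span0 : W 0.
Proof. by apply/span_lagrangian => Z WZ; rewrite form0l. Qed.

Lemma span_sum I (s' : seq I) (P : pred I) (G : I -> L) :
  (forall i, W (G i)) -> W (\sum_(i <- s' | P i) G i).
Proof.
by move=> WG; elim/big_ind: _ => // [|X Y]; [exact: span0 | exact: spanD].
Qed.

(** The coefficient of b_q y^k in [1 (x) a, r]. *)
Definition ad_right a k q : L := \sum_i \sum_j \sum_(l < k.+1)
  lpC n (strc br b i j q * a 0 i l) *: fam (k - l) j.

Lemma span_ad_right a k q : W (ad_right a k q).
Proof.
by do 3![apply: span_sum => ?]; apply/spanZ/span_fam.
Qed.

Lemma ad_right_diag a a' k q :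
  B (diag n a') (ad_right a k q) = brx a a' 0 q k.
Proof.
rewrite form_sumr mxE ps_sumE; apply: eq_bigr => i _.
rewrite form_sumr ps_sumE; apply: eq_bigr => j _.
rewrite form_sumr -mulrA psC_mulE psME mulr_sumr; apply: eq_bigr => l _.
by rewrite formZr fam_dual mulrA.
Qed.

Lemma brx_skew a a' : brx a a' = - brx a' a.
Proof. exact: lie_br_skew. Qed.

Lemma ad_series_coef a p q k :
  ad_series br b a r p q k = ([diag n a, fam k q] + ad_right a k q) 0 p.
Proof.
rewrite mxDE mxE -[LHS]/(psf _ k + psf _ k); congr (_ + _).
  rewrite ps_sumE mxE; apply: eq_bigr => i _.
  rewrite ps_sumE; apply: eq_bigr => j _.
  by rewrite !mxE -mulrA !psC_mulE mulrA.
rewrite ps_sumE summxE; apply: eq_bigr => i _.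
rewrite ps_sumE summxE; apply: eq_bigr => j _.
rewrite -mulrA psC_mulE psME summxE mulr_sumr; apply: eq_bigr => l _.
by rewrite mxZE !mxE rmorphM mulrA.
Qed.

(** Each coefficient of [a (x) 1 + 1 (x) a, r] is orthogonal to the diagonal,
    hence lies on it, and it is found by pairing with the dual family. *)
Lemma ad_series_delta a : ad_series br b a r = - emb2 n (str_delta a).
Proof.
have rowE k q : [diag n a, fam k q] + ad_right a k q =
    diag n (\row_p - str_delta a p q k).
  have [u uE] : exists u, [diag n a, fam k q] + ad_right a k q = diag n u.
    apply: diag_perp => a'; rewrite formDr ad_right_diag -form_invariant.
    by rewrite -diag_brx fam_dual brx_skew mxE [X in X + _]/= addNr.
  rewrite uE; congr (diag n _); apply/rowP => p; apply: psP => l; rewrite mxE.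
  rewrite -[RHS]/(- psf _ l) str_deltaE -fam_dual -uE formDl.
  rewrite (span_iso (span_ad_right _ _ _) (span_fam _ _)) addr0 form_invariant.
  by move: (fam k q) (fam l p) => X Y; rewrite brL_skew formNr.
apply/matrixP => p q; apply: psP => k.
by rewrite ad_series_coef rowE !mxE rmorphN.
Qed.

(** * The classical Yang-Baxter expression *)

(** CYB(r) is a power series in the third variable. With coefficients in A_2
    it maps to both A_3 and F((x_1))((x_2))[[x_3]], so that the identity proved
    here gives those in the two rings. *)
Definition cyb_ps : 'I_d -> 'I_d -> 'I_d -> ps A2 :=
  cyb3 br b (fun c => psC (lpC n (lpC n c)))
    (map_mx (fun f : ps A1 => psC (ps_lp n f)) r)
    (map_mx (ps_map (lpC n)) r)
    (map_mx (ps_map (lp_map (lpC n))) r).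

Definition emb_ps : ps (ps (ps F)) -> ps A2 :=
  ps_map (fun f => ps_lp n (ps_map (ps_lp n) f)).

Definition res_mul (y u : A1) : F := res (u * y).

Fact res_mul_additive y : zmod_morphism (res_mul y).
Proof. by move=> u v; rewrite /res_mul mulrBl raddfB. Qed.
HB.instance Definition _ y :=
  GRing.isZmodMorphism.Build A1 F (res_mul y) (res_mul_additive y).

Lemma res_mulZ y c u : res_mul y (lpC n c * u) = c * res_mul y u.
Proof. by rewrite /res_mul -mulrA (lp_resZ s_unit alphaP). Qed.

Definition contract_lp X (T : 'I_d -> A2) : A1 :=
  \sum_p lp_map (res_mul (X 0 p)) (T p).

Lemma form_nondeg X : (forall a, B (diag n a) X = 0) ->
  (forall k j, B (fam k j) X = 0) -> X = 0.
Proof.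
move=> /diag_perp[a ->] fa; rewrite -[RHS]diag0; congr (diag n _).
by apply/rowP => j; apply: psP => k; rewrite -fam_dual formC fa mxE.
Qed.

(** The form is nondegenerate, so that a tensor is determined by the
    contractions of its first factor; the diagonal and the dual family suffice. *)
Lemma contract_lp_inj (T T' : 'I_d -> A2) :
  (forall a, contract_lp (diag n a) T = contract_lp (diag n a) T') ->
  (forall k j, contract_lp (fam k j) T = contract_lp (fam k j) T') ->
  T =1 T'.
Proof.
move=> Td Tf p.
have c1 X (U : 'I_d -> A2) e : (contract_lp X U).1 e =
    B (\row_i (U i).1 e) X.
  rewrite lp_sum1 ls_sumE formE /dot raddf_sum.
  by apply: eq_bigr => i _; rewrite mxE.
have c2 X (U : 'I_d -> A2) k : (k < n)%N -> (contract_lp X U).2 k =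
    B (\row_i (U i).2 k) X.
  move=> kn; rewrite lp_sum2 tp_sumE formE /dot raddf_sum.
  by apply: eq_bigr => i _; rewrite mxE tp_truncE kn.
have eq_row (u v : L) : (forall a, B u (diag n a) = B v (diag n a)) ->
    (forall k j, B u (fam k j) = B v (fam k j)) -> u = v.
  move=> ud uf; apply/eqP; rewrite -subr_eq0; apply/eqP/form_nondeg => *.
    by rewrite formC formDl formNl ud subrr.
  by rewrite formC formDl formNl uf subrr.
apply: lpP => e.
  have /rowP/(_ p) : \row_i (T i).1 e = \row_i (T' i).1 e :> L.
    by apply: eq_row => *; rewrite -!c1 ?Td ?Tf.
  by rewrite !mxE.
case: (ltnP e n) => en; last by rewrite !tp_bnd.
have /rowP/(_ p) : \row_i (T i).2 e = \row_i (T' i).2 e :> L.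
  by apply: eq_row => *; rewrite -!c2 ?Td ?Tf.
by rewrite !mxE.
Qed.

Lemma contract_lpD X (T T' : 'I_d -> A2) :
  contract_lp X (fun p => T p + T' p) = contract_lp X T + contract_lp X T'.
Proof. by rewrite -big_split; apply: eq_bigr => p _; rewrite raddfD. Qed.

Lemma contract_lpN X (T : 'I_d -> A2) :
  contract_lp X (fun p => - T p) = - contract_lp X T.
Proof. by rewrite -sumrN; apply: eq_bigr => p _; rewrite raddfN. Qed.

Lemma contract_lp_ps X (T : 'I_d -> ps A1) :
  contract_lp X (fun p => ps_lp n (T p)) =
  ps_lp n (Ps (fun k => B (\row_p T p k) X)).
Proof.
rewrite /contract_lp (eq_bigr (fun p => ps_lp n (ps_map (res_mul (X 0 p)) (T p)))).
  rewrite -raddf_sum; congr (ps_lp n _); apply: psP => k.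
  rewrite ps_sumE [RHS]formE /dot raddf_sum.
  by apply: eq_bigr => p _; rewrite mxE.
by move=> p _; rewrite lp_map_ps.
Qed.

Lemma lp_map_res_scalar y (x : A1) (u : A2) :
  lp_map (res_mul y) (lp_map (lpC n) x * u) = x * lp_map (res_mul y) u.
Proof.
rewrite mulrC [RHS]mulrC.
rewrite (@lp_map_mul _ _ n F (res_mul y) (res_mul y) (lpC n) idfun).
  congr (_ * _); apply: lpP => e //=; case: ltnP => // en.
  by rewrite tp_bnd.
by move=> v c; rewrite [v * _]mulrC [RHS]mulrC; exact: res_mulZ.
Qed.

Lemma lp_map_resC y (x : A1) (u : A2) :
  lp_map (res_mul y) (lpC n x * u) = lp_map (res_mul (x * y)) u.
Proof.
have E v : res_mul y (x * v) = res_mul (x * y) v.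
  by rewrite /res_mul -mulrA mulrCA.
apply: lpP => e.
  by rewrite -[LHS]/(res_mul y ((lpC n x * u).1 e)) lpC_mul1; exact: E.
rewrite !tp_truncE; case: ifP => // _.
by rewrite -[LHS]/(res_mul y ((lpC n x * u).2 e)) lpC_mul2; exact: E.
Qed.

Lemma lp_map_res_lpC y (x w : A1) :
  lp_map (res_mul y) (lpC n x * lp_map (lpC n) w) = lpC n (res_mul y x) * w.
Proof. by rewrite mulrC lp_map_res_scalar lp_mapC mulrC. Qed.

Lemma contract_lp_r Y q :
  contract_lp Y (fun p => ps_lp n (r p q)) = diag n (projD Y) 0 q.
Proof.
rewrite contract_lp_ps !mxE; congr (ps_lp n _); apply: psP => k.
by rewrite [LHS]formC.
Qed.

Section Coefficient.
Variables (m : nat) (t : 'I_d).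
Let v := fam m t.

(* the coefficients of x_3^m in [r12, r13], [r12, r23] and [r13, r23] *)
Let t1 p q : A2 := \sum_i \sum_j
  lpC n (lpC n (strc br b i j p)) * ps_lp n (r i q) * lpC n (v 0 j).
Let t2 p q : A2 := \sum_i \sum_j
  lpC n (lpC n (strc br b i j q)) * ps_lp n (r p i) * lp_map (lpC n) (v 0 j).
Let t3 p q : A2 := \sum_i \sum_j \sum_(k < m.+1)
  lpC n (lpC n (strc br b i j t)) *
  (lpC n (r p i k) * lp_map (lpC n) (r q j (m - k)%N)).

Lemma cyb_ps_coef p q : cyb_ps p q t m = t1 p q + t2 p q + t3 p q.
Proof.
rewrite /cyb_ps /cyb3 psDE psDE.
congr (_ + _ + _); rewrite ps_sumE; apply: eq_bigr => i _;
  rewrite ps_sumE; apply: eq_bigr => j _.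
- by rewrite !mxE -mulrA !psC_mulE mulrA.
- by rewrite !mxE -mulrA !psC_mulE mulrA.
by rewrite !mxE -mulrA psC_mulE psME mulr_sumr.
Qed.

Lemma contract_t1 Y q : contract_lp Y (t1^~ q) = - diag n (projD [Y, v]) 0 q.
Proof.
rewrite -contract_lp_r -contract_lpN.
have -> : t1^~ q = fun p => - \sum_i \sum_j
    lpC n (lpC n (strc br b i j p)) * lpC n (v 0 i) * ps_lp n (r j q).
  apply/funext => p; rewrite /t1 exchange_big -sumrN; apply: eq_bigr => i _.
  rewrite -sumrN; apply: eq_bigr => j _.
  by rewrite (strc_skew b brP) !rmorphN !mulNr mulrAC.
rewrite !contract_lpN; congr (- _).
apply: (@contract_bracket _ _ (fun y => lp_map (res_mul y))
  (fun c => lpC n (lpC n c)) (fun i => lpC n (v 0 i)) v Y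
  (fun j => ps_lp n (r j q))).
- by move=> y u w; rewrite raddfB.
- move=> u y y'; have E w : res_mul (y + y') w = res_mul y w + res_mul y' w.
    by rewrite /res_mul mulrDr raddfD.
  apply: lpP => e; first exact: E.
  by rewrite tpDE !tp_truncE; case: ifP => _; [exact: E | rewrite addr0].
- by move=> c y u; rewrite lp_map_resC.
by move=> i y u; rewrite lp_map_resC.
Qed.

Lemma contract_t2 Y q : contract_lp Y (t2^~ q) = - [v, diag n (projD Y)] 0 q.
Proof.
have -> : t2^~ q = fun p => - \sum_i \sum_j
    lpC n (lpC n (strc br b i j q)) * lp_map (lpC n) (v 0 i) * ps_lp n (r p j).
  apply/funext => p; rewrite /t2 exchange_big -sumrN; apply: eq_bigr => i _.
  rewrite -sumrN; apply: eq_bigr => j _.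
  by rewrite (strc_skew b brP) !rmorphN !mulNr mulrAC.
rewrite contract_lpN; congr (- _); rewrite [RHS]mxE.
under [RHS]eq_bigr => i _ do under eq_bigr => j _ do rewrite -contract_lp_r.
apply: (@contract_scalar _ _ (fun p => lp_map (res_mul (Y 0 p)))
  (lp_map (lpC n)) (lpC n) (fun c => lpC n (lpC n c)) (v 0) _
  (fun p j => ps_lp n (r p j))) => [p x u|c|i] //.
  exact: lp_map_res_scalar.
by rewrite [RHS]lp_mapC.
Qed.

(** The contraction of the first factor of [r13, r23], at b_t x_3^m. *)
Definition cyb_rest Y : L := \sum_i \sum_j \sum_(k < m.+1)
  lpC n (strc br b i j t * B (fam k i) Y) *: fam (m - k) j.

Lemma span_cyb_rest Y : W (cyb_rest Y).
Proof. by do 3![apply: span_sum => ?]; apply/spanZ/span_fam. Qed.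

Lemma contract_t3 Y q : contract_lp Y (t3^~ q) = cyb_rest Y 0 q.
Proof.
rewrite summxE /contract_lp.
under eq_bigr => p _ do rewrite raddf_sum.
rewrite exchange_big; apply: eq_bigr => i _; rewrite summxE.
under eq_bigr => p _ do rewrite raddf_sum.
rewrite exchange_big; apply: eq_bigr => j _; rewrite summxE.
under eq_bigr => p _ do rewrite raddf_sum.
rewrite exchange_big; apply: eq_bigr => k _; rewrite mxZE [fam _ _ _ _]mxE.
have -> : B (fam k i) Y = \sum_p res_mul (Y 0 p) (r p i k).
  by rewrite formE /dot raddf_sum; apply: eq_bigr => p _; rewrite mxE.
rewrite rmorphM (raddf_sum (lpC n)) mulr_sumr mulr_suml; apply: eq_bigr => p _.
have -> : lpC n (lpC n (strc br b i j t)) =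
  lp_map (lpC n) (lpC n (strc br b i j t)) by rewrite lp_mapC.
apply: etrans (lp_map_res_scalar _ _ _) _; rewrite -[RHS]mulrA.
exact: congr1 (lp_map_res_lpC _ _ _).
Qed.

Lemma cyb_rest_diag a a' : B (diag n a') (cyb_rest (diag n a)) = brx a a' 0 t m.
Proof.
rewrite form_sumr mxE ps_sumE; apply: eq_bigr => i _.
rewrite form_sumr ps_sumE; apply: eq_bigr => j _.
rewrite form_sumr -mulrA psC_mulE psME mulr_sumr; apply: eq_bigr => l _.
by rewrite formZr fam_dual formC fam_dual mulrA.
Qed.

Lemma cyb_rest_fam k p : cyb_rest (fam k p) = 0.
Proof.
rewrite /cyb_rest big1 // => i _; rewrite big1 // => j _; rewrite big1 // => l _.
by rewrite fam_iso mulr0 rmorph0 scale0r.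
Qed.
Lemma contract_cyb Y q : contract_lp Y (fun p => cyb_ps p q t m) =
  (- diag n (projD [Y, v]) - [v, diag n (projD Y)] + cyb_rest Y) 0 q.
Proof.
have -> : (fun p => cyb_ps p q t m) = fun p => t1 p q + t2 p q + t3 p q.
  by apply/funext => p; exact: cyb_ps_coef.
have mxN (u : L) : (- u) 0 q = - u 0 q by rewrite mxE.
by rewrite !contract_lpD contract_t1 contract_t2 contract_t3 !mxDE !mxN.
Qed.

Lemma contract_emb_phi Y q :
  contract_lp Y (fun p => - ps_lp n (ps_map (ps_lp n) (str_phi p q t m))) =
  - ps_lp n (contract3 Y str_phi q t m).
Proof.
rewrite contract_lpN contract_lp_ps; congr (- ps_lp n _); apply: psP => l.
rewrite mxE; congr (B _ Y).
by apply/rowP => p; rewrite !mxE.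
Qed.

(** On the diagonal the two projections combine to the component in [W] of
    [diag a, v]. It lies in [W] together with [cyb_rest], and their sum is also
    orthogonal to the diagonal. *)
Lemma cyb_ps_diag a :
  - diag n (projD [diag n a, v]) - [v, diag n (projD (diag n a))]
  + cyb_rest (diag n a) = 0.
Proof.
rewrite projD_diag (brL_skew v) opprK.
rewrite [- _ + _]addrC -[_ - _]/(projW _).
apply: form_nondeg => [a'|k j]; last first.
  exact: span_iso (span_fam _ _) (spanD (projW_span _) (span_cyb_rest _)).
rewrite formDr cyb_rest_diag /projW formDr formNr form_diag subr0.
rewrite -form_invariant -diag_brx fam_dual brx_skew mxE.
by rewrite [X in X + _]/= addNr.
Qed.

Lemma cyb_ps_fam k p : - diag n (projD [fam k p, v])
  - [v, diag n (projD (fam k p))] + cyb_rest (fam k p) =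
  - diag n (projD [fam k p, v]).
Proof.
rewrite cyb_rest_fam (projD_span (span_fam _ _)) diag0 brL0r.
by rewrite subr0 addr0.
Qed.
End Coefficient.

(** Contracting the first factor of r with X gives the projection of X to the
    diagonal. Hence for X in [W] only [r12, r13] contributes, by the projection
    of the bracket of X and the coefficient of r at b_t x_3^m, which is the
    contraction of - phi. For X on the diagonal all three terms cancel, and phi
    contracts to 0. *)
Lemma cyb_ps_phi p q t : cyb_ps p q t = - emb_ps (str_phi p q t).
Proof.
apply: psP => m.
apply: (@contract_lp_inj (fun p => cyb_ps p q t m)
  (fun p => - ps_lp n (ps_map (ps_lp n) (str_phi p q t m)))) => [a|k p'].
  rewrite contract_cyb contract_emb_phi cyb_ps_diag contract3_diag mxE.
  by rewrite mxE [X in - X]raddf0 oppr0.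
rewrite contract_cyb contract_emb_phi cyb_ps_fam mxE [X in - X]mxE.
congr (- ps_lp n _); apply: psP => l.
rewrite projDE -pair2_fam -pair3E pair3_fam str_phiE.
move: (fam k p') (fam l q) (fam m t) => X Y Z.
by rewrite !form_invariant (brL_skew Z) formNr.
Qed.
End ManinPair.

(** * Skew-symmetric series and Lagrangian complements *)

Section SeriesOfType.
Variables (F : fieldType) (d n : nat) (s : ps F).
Local Notation L := 'rV[lp n F]_d.

(** The coefficient of b_j y^k in s(x) y^n Omega / (x - y). *)
Definition yang_fam k (j : 'I_d) : L :=
  \row_i (if i == j then ps_lp n s * kern F n k else 0).

Lemma ns_typeE (G : 'M[ps (ps F)]_d) i j k :
  ns_type n s G i j k =
  (if i == j then ps_lp n s * kern F n k else 0) + ps_lp n (G i j k).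
Proof.
rewrite mxDE psDE !mxE; congr (_ + _).
by case: eqP => _; rewrite ?mulr0n // mulr1n psC_mulE.
Qed.

Lemma fam_ns_type (G : 'M[ps (ps F)]_d) k j :
  fam (ns_type n s G) k j = yang_fam k j + diag n (\row_i G i j k).
Proof. by apply/rowP => i; rewrite mxDE mxE ns_typeE !mxE. Qed.

Lemma kern_coefC k l : kern_coef n s k l = kern_coef n s l k.
Proof.
by rewrite /kern_coef (addrC k%:Z) (andbC (n <= k)%N) (andbC (k < n)%N).
Qed.

Lemma emb2_inj : injective (@emb2 F d n).
Proof.
move=> T T' TT'; apply/matrixP => i j; apply: psP => k; apply: (@ps_lp_inj _ n).
by have /matrixP/(_ i j)/(congr1 (fun f : ps (lp n F) => f k)) := TT'; rewrite !mxE.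
Qed.

(** Subtracting s(x) y^n Omega / (x - y) from both sides of the skew-symmetry
    condition leaves an equation between power series, here read coefficient by
    coefficient. *)
Lemma skew_seriesP (G : 'M[ps (ps F)]_d) :
  skew_series s (ns_type n s G) <->
  forall k i l j, (if i == j then kern_coef n s k l else 0)
                  + G j i k l + G i j l k = 0.
Proof.
have emb2B (T T' : 'M[ps (ps F)]_d) : emb2 n (T - T') = emb2 n T - emb2 n T'.
  exact: (map_mxB (ps_map (ps_lp n))).
have emb2N (T : 'M[ps (ps F)]_d) : emb2 n (- T) = - emb2 n T.
  exact: (map_mxN (ps_map (ps_lp n))).
have coef h : h = kern_quot n s -> G = - h%:M - tau_swap G <->
    forall k i l j, (if i == j then kern_coef n s k l else 0)
                  + G j i k l + G i j l k = 0.
  move=> ->; have E i j l k : (- (kern_quot n s)%:M - tau_swap G) i j l k =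
      - ((if i == j then kern_coef n s k l else 0) + G j i k l).
    rewrite opprD !mxE; congr (_ - _); rewrite kern_coefC.
    by case: eqP => _; rewrite ?mulr1n // mulr0n /= oppr0.
  split=> [GE k i l j|G0].
    by have := E i j l k; rewrite -GE => ->; rewrite subrr.
  apply/matrixP => i j; apply: psP => l; apply: psP => k; rewrite E.
  by apply/eqP; rewrite -addr_eq0 addrC G0.
have nsE (T : 'M[ps (ps F)]_d) : ns_type n s T = yang d n s + emb2 n T by [].
split=> [[G' [h [GG' /kern_quotP hE rE]]]|G0].
  have {GG'} GG' : G' = G by move: GG' => /addrI/emb2_inj.
  apply/(coef h) => //; apply: emb2_inj; rewrite emb2B emb2N.
  by move: rE; rewrite nsE -addrA GG' => /addrI.
exists G, (kern_quot n s); split; [exact: erefl | exact/kern_quotP |].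
have GE := (coef _ erefl).2 G0.
by rewrite -addrA -emb2N -emb2B -GE.
Qed.
End SeriesOfType.

Section SkewSeries.
Variables (F : fieldType) (g : vectType F) (br : g -> g -> g).
Variables (d : nat) (b : d.-tuple g).
Hypothesis b_orth : forall i j : 'I_d, killing br b`_i b`_j = (i == j)%:R.
Variables (n : nat) (s : ps F) (alpha : ls F).
Hypothesis s_unit : ps_unit s.
Hypothesis alphaP : is_alpha n s alpha.
Local Notation B := (@formL F g br d b n alpha).

Lemma form_yang_dual (a : 'rV[ps F]_d) k j :
  B (diag n a) (yang_fam n s k j) = a 0 j k.
Proof.
rewrite form_diag_row // (bigD1 j) //= big1 ?addr0 => [|i /negbTE ij].
  by rewrite mxE eqxx (lp_res_kern s_unit alphaP).
by rewrite mxE ij mulr0 raddf0.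
Qed.

Lemma form_yang_yang k i l j : B (yang_fam n s k i) (yang_fam n s l j) =
  if i == j then kern_coef n s k l else 0.
Proof.
rewrite formE // /dot (bigD1 i) //= big1 ?addr0 => [|i' /negbTE ii].
  rewrite !mxE eqxx; case: eqP => _; last by rewrite mulr0 raddf0.
  exact: (lp_res_kern2 s_unit alphaP).
by rewrite mxE ii mul0r.
Qed.

Lemma fam_ns_dual (G : 'M[ps (ps F)]_d) (a : 'rV[ps F]_d) k j :
  B (diag n a) (fam (ns_type n s G) k j) = a 0 j k.
Proof.
rewrite fam_ns_type formDr // (form_diag b_orth s_unit alphaP) addr0.
exact: form_yang_dual.
Qed.

Lemma fam_ns_pair (G : 'M[ps (ps F)]_d) k i l j :
  B (fam (ns_type n s G) k i) (fam (ns_type n s G) l j) =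
  (if i == j then kern_coef n s k l else 0) + G j i k l + G i j l k.
Proof.
rewrite [X in B X _]fam_ns_type formDl // fam_ns_dual fam_ns_type formDr //.
rewrite form_yang_yang (formC b_orth alpha (yang_fam _ _ _ _)) form_yang_dual !mxE.
by rewrite addrAC.
Qed.

(** The pairings of the coefficients of a series are the coefficients of
    g + tau(g(y,x)) + (s(x) y^n - s(y) x^n) Omega / (x - y). *)
Lemma skew_series_iso (G : 'M[ps (ps F)]_d) :
  skew_series s (ns_type n s G) <-> forall k i l j,
    B (fam (ns_type n s G) k i) (fam (ns_type n s G) l j) = 0.
Proof.
rewrite skew_seriesP; split=> H k i l j; first by rewrite fam_ns_pair H.
by rewrite -fam_ns_pair H.
Qed.

Lemma skew_dual r : skew_series s r ->
  (forall a k j, B (diag n a) (fam r k j) = a 0 j k) /\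
  (forall k i l j, B (fam r k i) (fam r l j) = 0).
Proof.
move=> sk; have [G [h [rE _ _]]] := sk; rewrite rE in sk *.
by split; [exact: fam_ns_dual | apply/skew_series_iso].
Qed.

(** The component along the complement of the coefficients of
    s(x) y^n Omega / (x - y) gives the series of a Lagrangian complement. *)
Lemma series_of_lagrangian (W : 'rV[lp n F]_d -> Prop) :
  lagrangian br b alpha W -> complementary W ->
  exists2 r, skew_series s r & forall w, span_series r w <-> W w.
Proof.
move=> Wlag [Wsplit W0].
have W_iso u v : W u -> W v -> B u v = 0 by move=> /Wlag + Wv; apply.
have WD u v : W u -> W v -> W (u + v).
  by move=> Wu Wv; apply/Wlag => z Wz; rewrite formDl // !W_iso ?addr0.
have WZ c u : W u -> W (lpC n c *: u).
  by move=> Wu; apply/Wlag => z Wz; rewrite (formZl b_orth s_unit alphaP) W_iso ?mulr0.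
have Wz : W 0 by apply/Wlag => z _; rewrite form0l.
have [a aP] := choice (fun x : nat * 'I_d => Wsplit (yang_fam n s x.1 x.2)).
pose G : 'M[ps (ps F)]_d := \matrix_(i, j) Ps (fun k => - a (k, j) 0 i).
have Wfam k j : W (fam (ns_type n s G) k j).
  have [w [Ww wE]] := aP (k, j); rewrite fam_ns_type [yang_fam _ _ _ _]wE.
  have -> : \row_i G i j k = - a (k, j) by apply/rowP => i; rewrite !mxE.
  by rewrite diagN addrAC subrr add0r.
have sk : skew_series s (ns_type n s G) by apply/skew_series_iso => *; apply: W_iso.
have [fd fi] := skew_dual sk.
have spanW w : span_series (ns_type n s G) w -> W w.
  exact: span_ind_fam.
exists (ns_type n s G) => // w; split=> [|Ww]; first exact: spanW.
have [splitW _] := span_complementary b_orth s_unit alphaP fd fi.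
have [u [v [Wv wE]]] := splitW w.
have : W (diag n u).
  have -> : diag n u = w + lpC n (-1) *: v by rewrite wE rmorphN1 scaleN1r addrK.
  by apply: WD => //; apply/WZ/spanW.
by move/W0 => u0; rewrite wE u0 add0r.
Qed.
End SkewSeries.

(** * Laurent series *)

Section Naturality.
Variables (F : fieldType) (g : vectType F) (br : g -> g -> g).
Variables (d : nat) (b : d.-tuple g).

Lemma act2_morph (C C' : comPzRingType) (h : {rmorphism C -> C'})
    (sc : F -> C) (sc' : F -> C') (X Y : 'rV_d) (T : 'M_d)
    (X' Y' : 'rV_d) (T' : 'M_d) :
  (forall c, sc' c = h (sc c)) -> (forall i, X' 0 i = h (X 0 i)) ->
  (forall i, Y' 0 i = h (Y 0 i)) -> (forall i j, T' i j = h (T i j)) ->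
  act2 br b sc' X' Y' T' = map_mx h (act2 br b sc X Y T).
Proof.
move=> scE XE YE TE; apply/matrixP => p q; rewrite !mxE rmorphD.
by congr (_ + _); rewrite rmorph_sum; apply: eq_bigr => i _;
   rewrite rmorph_sum; apply: eq_bigr => j _; rewrite !rmorphM scE ?XE ?YE TE.
Qed.

Lemma cyb3_morph (C C' : comPzRingType) (h : {rmorphism C -> C'})
    (sc : F -> C) (sc' : F -> C') (R S T : 'M_d) (R' S' T' : 'M_d) p q t :
  (forall c, sc' c = h (sc c)) -> (forall i j, R' i j = h (R i j)) ->
  (forall i j, S' i j = h (S i j)) -> (forall i j, T' i j = h (T i j)) ->
  cyb3 br b sc' R' S' T' p q t = h (cyb3 br b sc R S T p q t).
Proof.
move=> scE RE SE TE; rewrite /cyb3 !rmorphD.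
by congr (_ + _ + _); rewrite rmorph_sum; apply: eq_bigr => i _;
   rewrite rmorph_sum; apply: eq_bigr => j _;
   rewrite !rmorphM scE ?RE ?SE ?TE.
Qed.

Lemma cyb_lp_ps n (r : 'M[ps (lp n F)]_d) p q t :
  cyb_lp br b r p q t = ps_lp n (cyb_ps br b r p q t).
Proof.
apply: (cyb3_morph (h := @ps_lp n _)) => [c|i j|i j|i j].
- by rewrite /= ps_lpC.
- by rewrite !mxE /= ps_lpC.
- by rewrite !mxE.
by rewrite !mxE.
Qed.

Lemma cyb_ls_ps n (r : 'M[ps (lp n F)]_d) p q t :
  cyb_ls br b (laurent r) p q t =
  ps_map (ls_map (@lp_fst n F) \o @lp_fst n (lp n F)) (cyb_ps br b r p q t).
Proof.
have lsC_map (R S : comPzRingType) (f : {additive R -> S}) x :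
    ls_map f (lsC x) = lsC (f x).
  by apply: lsP => m; rewrite /= /ls_monom (fun_if f) raddf0.
apply: (cyb3_morph (h := ps_map (ls_map (@lp_fst n F) \o @lp_fst n (lp n F)))).
- by move=> c; rewrite /= ps_map_psC /= lsC_map.
- move=> i j; rewrite !mxE /= ps_map_psC; congr psC.
  by apply: lsP => -[] k //=.
- by move=> i j; rewrite !mxE; apply: psP => k; rewrite /= lsC_map.
by move=> i j; rewrite !mxE; apply: psP => k; apply: lsP => m.
Qed.

Lemma ad_ls_series n (r : 'M[ps (lp n F)]_d) a :
  ad_ls br b a (laurent r) = map_mx (ps_map (@lp_fst n F)) (ad_series br b a r).
Proof.
apply: act2_morph => [c|i|i|i j].
- by rewrite /= ps_map_psC.
- by rewrite !mxE /= ps_map_psC.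
- by rewrite !mxE; apply: psP => k.
by rewrite !mxE.
Qed.
End Naturality.

Section Laurent.
Variables (F : fieldType) (d : nat).

Lemma laurentE n (r : 'M[ps (lp n F)]_d) i j k m :
  laurent r i j k m = (r i j k).1 m.
Proof. by rewrite mxE. Qed.

(** This recovers the type from the Laurent series: s starts with a nonzero
    coefficient, so that n is the first power of y with a residue. *)
Lemma laurent_residue n s (G : 'M[ps (ps F)]_d) i k :
  laurent (ns_type n s G) i i k (-1) = if (k < n)%N then 0 else s (k - n)%N.
Proof.
rewrite laurentE ns_typeE eqxx kernM.
have fstD (u v : lp n F) m : (u + v).1 m = u.1 m + v.1 m by [].
rewrite fstD [X in _ + X]/= addr0; case: ltnP => kn //.
rewrite [ps_ls s * _]mulrC -[LHS]/((lsX F _ * _) (-1)) lsX_mulE.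
by have -> : -1 - (n%:Z - 1 - k%:Z) = (k - n)%N by lia.
Qed.

Lemma laurent_inj (d_gt0 : (0 < d)%N) (x x' : series F d) :
  skew_ns_series x -> skew_ns_series x' ->
  laurent (ser_r x) = laurent (ser_r x') -> x = x'.
Proof.
case: x x' => n s r [n' s' r'] [/= [t st] [G [h [rE _ _]]]].
case=> /= [[t' st'] [G' [h' [rE' _ _]]]] rr.
have s0 u v : u * v = 1 :> ps F -> u 0%N != 0.
  move=> /(congr1 (fun f : ps F => f 0%N)); rewrite psME big_ord1 /= => uv.
  by apply/eqP => u0; move: uv; rewrite u0 mul0r => /esym/eqP; rewrite oner_eq0.
have res k : (if (k < n)%N then 0 else s (k - n)%N) =
             (if (k < n')%N then 0 else s' (k - n')%N).
  by rewrite -(laurent_residue n s G (Ordinal d_gt0))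
    -(laurent_residue n' s' G' (Ordinal d_gt0)) -rE -rE' rr.
have nn' : n = n'.
  case: (ltngtP n n') => // nn.
    by have /eqP := res n; rewrite ltnn nn subnn (negbTE (s0 _ _ st)).
  by have /eqP := res n'; rewrite ltnn nn subnn eq_sym (negbTE (s0 _ _ st')).
subst n'.
have ss' : s = s'.
  apply: psP => k; have := res (k + n)%N.
  by rewrite ltnNge leq_addl /= addnK.
subst s'; congr Series; rewrite rE rE'; congr (ns_type n s _).
apply/matrixP => i j; apply: psP => k; apply: psP => l.
have E : (r i j k).1 l = (r' i j k).1 l.
  exact: etrans (esym (laurentE r i j k l))
    (etrans (congr1 (fun R : 'M[ps (ls F)]_d => R i j k l) rr)
      (laurentE r' i j k l)).
have fstE (H : 'M[ps (ps F)]_d) : (ns_type n s H i j k).1 l =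
    (if i == j then ps_lp n s * kern F n k else 0).1 l + H i j k l.
  by rewrite ns_typeE.
by move: E; rewrite rE fstE rE' fstE => /addrI.
Qed.
End Laurent.

Section Uniqueness.
Variables (F : fieldType) (g : vectType F) (br : g -> g -> g).
Variables (d : nat) (b : d.-tuple g).
Hypothesis brP : lie_bracket br.
Hypothesis b_basis : basis_of fullv b.
Hypothesis b_orth : forall i j : 'I_d, killing br b`_i b`_j = (i == j)%:R.

(** Let T be killed by b_i and by b_i x. The bracket of b_i with the first
    factor of T is then annihilated by x - y, which is not a zero divisor; so the
    first factor of T commutes with every b_i, and T = 0 as g has no centre. *)
Lemma ad_ls_inj (R R' : 'M[ps (ls F)]_d) :
  (forall a, ad_ls br b a R = ad_ls br b a R') -> R = R'.
Proof.
move=> RR'; pose T := R - R'.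
have act0 a : ad_ls br b a T = 0.
  apply/matrixP => p q; have /matrixP/(_ p q)/eqP := RR' a.
  rewrite -subr_eq0 [X in X == 0 -> _](_ : _ = ad_ls br b a T p q); last first.
    rewrite !mxE opprD addrACA -!sumrB; congr (_ + _).
      apply: eq_bigr => i _; rewrite -sumrB; apply: eq_bigr => j _.
      by rewrite -mulrBr !mxE.
    apply: eq_bigr => i _; rewrite -sumrB; apply: eq_bigr => j _.
    by rewrite -mulrBr !mxE.
  by move/eqP ->; rewrite mxE.
pose U i p q := \sum_j psC (lsC (strc br b i j p)) * T j q.
pose V i p q := \sum_j psC (lsC (strc br b i j q)) * T p j.
pose e i f : 'rV[ps F]_d := \row_j (if j == i then f else 0).
have actE i f p q :
    psC (ps_ls f) * U i p q + ps_map (@lsC F) f * V i p q = 0.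
  have /matrixP/(_ p q) := act0 (e i f); rewrite !mxE => <-.
  congr (_ + _); rewrite (bigD1 i) //= [X in _ + X]big1 ?addr0 => [|i' /negbTE ii'].
  - rewrite mulr_sumr; apply: eq_bigr => j _.
    by rewrite !mxE eqxx mulrCA mulrA.
  - by rewrite big1 // => j _; rewrite !mxE ii' !raddf0 mulr0 mul0r.
  - rewrite mulr_sumr; apply: eq_bigr => j _.
    by rewrite !mxE eqxx mulrCA mulrA.
  by rewrite big1 // => j _; rewrite !mxE ii' !raddf0 mulr0 mul0r.
have UV i p q : U i p q + V i p q = 0.
  by have := actE i 1 p q; rewrite !rmorph1 !mul1r.
have U0 i p q : U i p q = 0.
  have VU : V i p q = - U i p q by apply/eqP; rewrite -addr_eq0 addrC UV.
  have XU : psC (lsX F 1) * U i p q = psX (ls F) * U i p q.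
    have := actE i (psX F) p q; rewrite VU mulrN => /eqP.
    have -> : ps_map (@lsC F) (psX F) = psX (ls F).
      by apply: psP => k; rewrite /= rmorph_nat.
    by rewrite subr_eq0 -[psX F]expr1 ps_lsXn => /eqP.
  have coefU k m : U i p q k m = if k is k'.+1 then U i p q k' (m + 1) else 0.
    have /(congr1 (fun f : ps (ls F) => f k (m + 1))) := XU.
    rewrite psC_mulE lsX_mulE addrK psX_mulE => ->.
    by case: k.
  apply: psP => k; apply: lsP; elim: k => [|k IH] m; rewrite coefU //.
  exact: IH.
have T0 : T = 0.
  apply/matrixP => j q; apply: psP => k; apply: lsP => m; rewrite [in RHS]mxE.
  have Z i p : \sum_j' strc br b i j' p * T j' q k m = 0.
    have /(congr1 (fun f : ps (ls F) => f k m)) := U0 i p q.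
    rewrite /U ps_sumE ls_sumE => U0m; rewrite -[RHS]U0m.
    by apply: eq_bigr => j' _; rewrite psC_mulE lsM_mulE subr0.
  exact: (strc_center brP b_basis b_orth Z j).
by apply/eqP; rewrite -subr_eq0 -/T T0.
Qed.
End Uniqueness.

(** * The correspondence *)

Section Alpha.
Variables (F : fieldType) (n : nat) (s : ps F).

Lemma alpha_exists : ps_unit s -> exists alpha, is_alpha n s alpha.
Proof.
case=> t st; exists (lsX F (- n%:Z) * ps_ls t).
rewrite /is_alpha mulrA lsXD subrr lsX0 mul1r -ps_lsM mulrC st.
exact: rmorph1.
Qed.

Lemma alpha_unique alpha alpha' :
  is_alpha n s alpha -> is_alpha n s alpha' -> alpha = alpha'.
Proof.
rewrite /is_alpha => a1 a1'; rewrite -[RHS]mul1r -a1 -[LHS]mul1r -a1'.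
by rewrite -!mulrA; congr (_ * _); rewrite mulrCA (mulrC _ alpha) mulrCA.
Qed.
End Alpha.

Section Correspondence.
Variables (F : fieldType) (F_char0 : [pchar F] =i pred0).
Variables (g : vectType F) (br : g -> g -> g) (d : nat) (b : d.-tuple g).
Hypothesis brP : lie_bracket br.
Hypothesis b_basis : basis_of fullv b.
Hypothesis b_orth : forall i j : 'I_d, killing br b`_i b`_j = (i == j)%:R.

Lemma corresponds_str (x : series F d) alpha delta phi :
  skew_ns_series x -> is_alpha (ser_n x) (ser_s x) alpha ->
  corresponds br b x delta phi ->
  delta = str_delta br b alpha (ser_r x) /\ phi = str_phi br b alpha (ser_r x).
Proof.
case: x => n s r [/= su sk] alphaP [beta [/= betaP _ _ st]].
rewrite (alpha_unique alphaP betaP).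
have [fd fi] := skew_dual b_orth su betaP sk.
exact: (structure_unique b_orth su betaP fd fi st).
Qed.

Lemma skew_series_tqlb (x : series F d) : skew_ns_series x ->
  exists delta phi,
    [/\ topological_quasi_lie_bialgebra br b delta phi,
        corresponds br b x delta phi
      & forall delta' phi', corresponds br b x delta' phi' ->
          delta' = delta /\ phi' = phi].
Proof.
move=> xsk; have [su sk] := xsk.
have [alpha alphaP] := alpha_exists (ser_n x) su.
have [fd fi] := skew_dual b_orth su alphaP sk.
exists (str_delta br b alpha (ser_r x)), (str_phi br b alpha (ser_r x)); split.
- exact: (str_tqlb brP b_basis b_orth su alphaP fd fi F_char0).
- exists alpha; split=> //.
  + exact: (span_lagrangian b_orth su alphaP fd fi).
  + exact: (span_complementary b_orth su alphaP fd fi).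
  exact: (str_structure brP b_orth su alphaP fd fi).
by move=> delta' phi'; apply: corresponds_str.
Qed.

Lemma series_identities (x : series F d) delta phi :
  skew_ns_series x -> corresponds br b x delta phi ->
  (forall a, ad_series br b a (ser_r x) = - emb2 (ser_n x) (delta a)) /\
  (forall i j k, cyb_ps br b (ser_r x) i j k = - emb_ps (ser_n x) (phi i j k)).
Proof.
move=> xsk xc; have [su sk] := xsk.
have [alpha alphaP] := alpha_exists (ser_n x) su.
have [fd fi] := skew_dual b_orth su alphaP sk.
have [-> ->] := corresponds_str xsk alphaP xc; split=> [a|i j k].
  exact: (ad_series_delta brP b_basis b_orth su alphaP fd fi).
exact: (cyb_ps_phi brP b_basis b_orth su alphaP fd fi).
Qed.

Lemma laurent_identities (x : series F d) delta phi :
  skew_ns_series x -> corresponds br b x delta phi ->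
  (forall a, ad_ls br b a (laurent (ser_r x)) = - emb2_ls (delta a)) /\
  (forall i j k, cyb_ls br b (laurent (ser_r x)) i j k =
                 - emb3_ls (phi i j k)).
Proof.
move=> xsk /(series_identities xsk)[adE cybE]; split=> [a|i j k].
  rewrite ad_ls_series adE raddfN; congr (- _).
  by apply/matrixP => p q; rewrite !mxE; apply: psP => k.
rewrite cyb_ls_ps cybE rmorphN; congr (- _).
by apply: psP => m; apply: lsP => -[] l //=; apply: lsP.
Qed.

(** The type of the series is determined as well: the Laurent series of x and
    x' have the same bracket with every a, namely - delta(a), so they agree, and
    the type can be read off them. *)
Lemma corresponds_inj (d_gt0 : (0 < d)%N) (x x' : series F d) delta phi :
  skew_ns_series x -> corresponds br b x delta phi ->
  skew_ns_series x' -> corresponds br b x' delta phi -> x' = x.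
Proof.
move=> xsk xc xsk' xc'; apply: laurent_inj => //.
apply: (ad_ls_inj brP b_basis b_orth) => a.
by rewrite (laurent_identities xsk' xc').1 (laurent_identities xsk xc).1.
Qed.

(** The structure depends on W alone, and the coefficients of the series built
    from W span W. *)
Lemma manin_pair_series n s alpha delta phi :
  ps_unit s -> is_alpha n s alpha ->
  @manin_pair_is F g br d b n alpha delta phi ->
  exists r : 'M[ps (lp n F)]_d,
    skew_ns_series (Series s r) /\ corresponds br b (Series s r) delta phi.
Proof.
move=> su alphaP [W [Wlag Wcompl Wst]].
have [r sk spanW] := series_of_lagrangian b_orth su alphaP Wlag Wcompl.
have [fd fi] := skew_dual b_orth su alphaP sk.
exists r; split=> //; exists alpha; split=> //=.
- exact: (span_lagrangian b_orth su alphaP fd fi).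
- exact: (span_complementary b_orth su alphaP fd fi).
move=> X Y u v /spanW WX /spanW WY /spanW Wv XY.
have [dE pE] := Wst _ _ _ _ WX WY Wv XY.
by split=> // Z /spanW; apply: pE.
Qed.

Lemma nonabelian_dim x y : br x y != 0 -> (0 < d)%N.
Proof.
rewrite lt0n; apply: contraNneq => d0.
rewrite (coord_basis b_basis (memvf y)) big1 => [|i _]; last first.
  by case: (i) => k kd; exfalso; move: kd; rewrite d0.
by rewrite -(ad_linE brP) linear0.
Qed.
End Correspondence.

Theorem proposition3 (F : closedFieldType) (F_char0 : [pchar F] =i pred0)
    (g : vectType F) (br : g -> g -> g) (g_simple : simple_lie br)
    (d : nat) (b : d.-tuple g) (b_basis : basis_of fullv b)
    (b_orthonormal : forall i j : 'I_d, killing br b`_i b`_j = (i == j)%:R) :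
  [/\ (* every skew-symmetric series determines one quasi-Lie bialgebra *)
      forall x : series F d, skew_ns_series x ->
        exists delta phi,
          [/\ topological_quasi_lie_bialgebra br b delta phi,
              corresponds br b x delta phi
            & forall delta' phi', corresponds br b x delta' phi' ->
                delta' = delta /\ phi' = phi],
      (* every quasi-Lie bialgebra with Manin pair (L(n, alpha), Delta) is
         determined by exactly one skew-symmetric series *)
      forall (n : nat) (s : ps F) (alpha : ls F) delta phi,
        ps_unit s -> is_alpha n s alpha ->
        topological_quasi_lie_bialgebra br b delta phi ->
        @manin_pair_is F g br d b n alpha delta phi ->
        exists r : 'M[ps (lp n F)]_d, let x := Series s r in
          [/\ skew_ns_series x, corresponds br b x delta phi
            & forall x', skew_ns_series x' -> corresponds br b x' delta phi ->
                x' = x],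
      (* the identities, under g[[x]] = Delta *)
      forall (x : series F d) delta phi,
        skew_ns_series x -> corresponds br b x delta phi ->
        (forall a, ad_series br b a (ser_r x) = - emb2 (ser_n x) (delta a)) /\
        (forall i j k, cyb_lp br b (ser_r x) i j k =
                       - emb3 (ser_n x) (phi i j k)),
      (* the bijection and the identities in (g (x) g)((x))[[y]] *)
      forall x x' : series F d, skew_ns_series x -> skew_ns_series x' ->
        laurent (ser_r x) = laurent (ser_r x') -> x = x'
    & forall (x : series F d) delta phi,
        skew_ns_series x -> corresponds br b x delta phi ->
        (forall a, ad_ls br b a (laurent (ser_r x)) = - emb2_ls (delta a)) /\
        (forall i j k, cyb_ls br b (laurent (ser_r x)) i j k =
                       - emb3_ls (phi i j k))].
Proof.
have brP := simple_lie_bracket g_simple.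
have d_gt0 : (0 < d)%N.
  have [x [y xy]] := simple_lie_nonabelian g_simple.
  exact: (nonabelian_dim brP b_basis xy).
split.
- exact: (skew_series_tqlb F_char0 brP b_basis b_orthonormal).
- move=> n s alpha delta phi su alphaP _.
  move=> /(manin_pair_series b_orthonormal su alphaP)[r [sk cr]].
  exists r; split=> // x' sk' cr'.
  exact: (corresponds_inj brP b_basis b_orthonormal d_gt0 sk cr sk' cr').
- move=> x delta phi sk cr.
  have [adE cybE] := series_identities brP b_basis b_orthonormal sk cr.
  by split=> // i j k; rewrite cyb_lp_ps cybE raddfN.
- exact: laurent_inj.
exact: (laurent_identities brP b_basis b_orthonormal).
Qed.
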